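(* Let $r\in\mathbb{N}_{\ge 1}$ and let $M=(M_p)_{p\in\mathbb{N}}$, $N=(N_p)_{p\in\mathbb{N}}$ be sequences of positive real numbers such that $M,N\in\mathcal{LC}$, $\liminf_{p\to\infty}\left(\frac{(M_p)^{1/r}}{p!}\right)^{1/p}>0$, and there is a constant $C\ge 1$ with $M_p\le C^pN_p$ for all $p\in\mathbb{N}$. Then $$\Lambda_{\{M\}}\subseteq\{(f^{(rj)}(0))_{j\in\mathbb{N}}:\ f\in\mathcal{D}_{r,\{N\}}([-1,1])\}$$ if and only if condition $(M,N)_{SV_r}$ holds.
   Context: $\mathbb{N}=\{0,1,2,\dots\}$, $\mathbb{N}_{>0}=\{1,2,\dots\}$. For sequences $M,N$ of positive reals put $\mu_p=M_p/M_{p-1}$, $\nu_p=N_p/N_{p-1}$ for $p\ge1$, $\mu_0=\nu_0=1$. $\mathcal{LC}$ is the set of all positive sequences $M$ that are normalized ($1=M_0\le M_1$), log-convex ($M_j^2\le M_{j-1}M_{j+1}$ for all $j\ge 1$), and satisfy $\lim_{k\to\infty}(M_k)^{1/k}=\infty$. For $p,s\in\mathbb{N}_{>0}$ let $\lambda^{M,N}_{p,s}:=\sup_{0\le j<p}\left(\frac{M_p}{s^pN_j}\right)^{1/(p-j)}$. Condition $(M,N)_{SV_r}$ means: there exists $s\in\mathbb{N}_{>0}$ such that $\sup_{p\in\mathbb{N}_{>0}}\frac{(\lambda^{M,N}_{p,s})^{1/r}}{p}\sum_{k\ge p}\left(\frac{1}{\nu_k}\right)^{1/r}<\infty$ (in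 particular the series converges). $\Lambda_{\{M\}}$ is the set of all complex sequences $(a_p)_{p\in\mathbb{N}}$ for which there is $h>0$ with $\sup_{p\in\mathbb{N}}\frac{|a_p|}{h^pM_p}<\infty$. $\mathcal{D}_{r,\{N\}}([-1,1])$ is the set of all $\mathcal{C}^\infty$ functions $f:\mathbb{R}\to\mathbb{C}$ with support in $[-1,1]$, with $f^{(rn+j)}(0)=0$ for all $n\in\mathbb{N}$ and $j\in\{1,\dots,r-1\}$, and such that for some $h>0$ one has $\sup_{n\in\mathbb{N},x\in\mathbb{R}}\frac{|f^{(rn)}(x)|}{h^nN_n}<\infty$. *)

(* Defs.v *)
From Stdlib Require Import Reals Factorial Lra Lia.
From Coquelicot Require Import Coquelicot.

Open Scope R_scope.

(* Supremum in the extended reals of the family (F i), i ranging over the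
   indices satisfying P; it is p_infty when the family is unbounded above. *)
Definition sup_over {I : Type} (P : I -> Prop) (F : I -> R) : Rbar :=
  Lub_Rbar (fun y => exists i, P i /\ y = F i).

Definition quot (N : nat -> R) (p : nat) : R :=
  match p with
  | O => 1
  | S q => N (S q) / N q
  end.

(* In terms of the form [Rpower _ (/ INR k)] the index k = 0 is harmless: they
   occur only in limits as k tends to infinity or with k > 0. *)
Record LC (M : nat -> R) : Prop := {
  LC_pos : forall p, 0 < M p;
  LC_zero : M 0%nat = 1;
  LC_one : 1 <= M 1%nat;
  LC_logconvex :
    forall j, (1 <= j)%nat -> M j ^ 2 <= M (j - 1)%nat * M (j + 1)%nat;
  LC_root : is_lim_seq (fun k => Rpower (M k) (/ INR k)) p_infty
}.

(* For p > 0 the supremum is that of a finite nonempty set, so that [real]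
   loses nothing. *)
Definition lambda (M N : nat -> R) (p s : nat) : R :=
  real (sup_over (fun j => (j < p)%nat)
         (fun j => Rpower (M p / (INR s ^ p * N j)) (/ INR (p - j)))).

(* [Series] is total, so the convergence of the series is a separate clause. *)
Definition SV (r : nat) (M N : nat -> R) : Prop :=
  exists s : nat, (0 < s)%nat /\
    (forall p, (0 < p)%nat ->
       ex_series (fun k => Rpower (/ quot N (p + k)) (/ INR r))) /\
    Rbar_lt
      (sup_over (fun p => (0 < p)%nat)
         (fun p => Rpower (lambda M N p s) (/ INR r) / INR p *
                   Series (fun k => Rpower (/ quot N (p + k)) (/ INR r))))
      p_infty.

Definition LambdaR (M : nat -> R) (a : nat -> C) : Prop :=
  exists h, 0 < h /\
    Rbar_lt (sup_over (fun _ : nat => True)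
               (fun p => Cmod (a p) / (h ^ p * M p)))
            p_infty.

Definition CDerive_n (f : R -> C) (n : nat) (x : R) : C :=
  (Derive_n (fun t => Re (f t)) n x, Derive_n (fun t => Im (f t)) n x).

Definition Csmooth (f : R -> C) : Prop :=
  forall n x, ex_derive_n (fun t => Re (f t)) n x /\
              ex_derive_n (fun t => Im (f t)) n x.

Definition support (f : R -> C) : R -> Prop :=
  adherence (fun x => f x <> RtoC 0).

Record DR (r : nat) (N : nat -> R) (f : R -> C) : Prop := {
  DR_smooth : Csmooth f;
  DR_support : included (support f) (fun x => -1 <= x <= 1);
  DR_zero : forall n j, (1 <= j <= r - 1)%nat ->
    CDerive_n f (r * n + j) 0 = RtoC 0;
  DR_bound : exists h, 0 < h /\
    Rbar_lt (sup_over (fun _ : nat * R => True)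
               (fun nx => Cmod (CDerive_n f (r * fst nx) (snd nx)) /
                          (h ^ fst nx * N (fst nx))))
            p_infty
}.

Definition borel_image (r : nat) (N : nat -> R) (a : nat -> C) : Prop :=
  exists f, DR r N f /\ forall j, a j = CDerive_n f (r * j) 0.

(* Main.v *)
(*
  Write nu_k for the r-th root of N_k / N_(k-1) and l_p for the r-th root of lambda_(p,s).

  (SV => surjectivity) For each p an infinite iteration of moving averages, r p of them of
  width ~ 1/l_p and then r of width ~ 1/nu_k for each k > p, produces a cutoff phi_p which is
  1 near 0 and, by (SV), supported in |x| <= eps p / l_p.  By the definition of l_p, the
  kernels x^(rp)/(rp)! phi_p satisfy the bounds of the class with constants (const * eps)^p,
  so that their combination with coefficients a_p converges for eps small.  The liminf
  hypothesis says that p / l_p is bounded, which keeps the supports inside [-1,1].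

  (surjectivity => SV) Baire's theorem and successive approximation give kernels f_p with
  jet the p-th unit vector and |f_p^(rn)| <= A h^n N_n / M_p, with A and h independent of p.
  The function x^(rp)/(rp)! - f_p is flat at 0 and its derivatives of order rk, k > p, are
  those of -f_p, so Bang's proof of the Denjoy-Carleman theorem bounds its derivatives of
  order rj, j < p, by A h^(rj) N_j / M_p up to the point T = const * sum_(k > p) 1/nu_k.
  There the monomial can thus not exceed twice this bound, that is, T <= const * p / l_p.
*)
Require Import Defs.
From Stdlib Require Import Reals Factorial Lra Lia.
From Stdlib Require Import IndefiniteDescription Classical.
From Coquelicot Require Import Coquelicot.

Open Scope R_scope.

(** * Smooth functions and termwise differentiation *)

(** Two features shape the proof. The class bounds only the derivatives of order r n. Hence nu_k is
    an r-th root: one quotient of N is spread evenly over r orders, which gives r averages for each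
    k in the cutoffs and majorants of all orders for Bang's estimate. Where orders in between matter
    only for termwise differentiation, crude bounds suffice, obtained by integrating from outside
    the support. Second, the integer s in (SV) may be enlarged, as this only lowers lambda.
    Sufficiency enlarges it until M_p <= s^p N_p, which forces l_p <= nu_k for k >= p: the averages
    of width ~ 1/l_p are then the widest, and derivatives that fall on the monomial instead of the
    cutoff are paid for by powers of l_p. Necessity picks s itself and lets s^p absorb A, h and the
    constant comparing M with N. Baire's theorem enters because the class is a union over h:
    solvability for each single sequence gives no common h. All estimates are made for real
    functions. *)

Definition smooth (f : R -> R) : Prop := forall n x, ex_derive_n f n x.

Lemma is_derive_Derive_n (f : R -> R) (n : nat) (x : R) :
  smooth f -> is_derive (Derive_n f n) x (Derive_n f (S n) x).
Proof. intros Hf. apply Derive_correct. exact (Hf (S n) x). Qed.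

(** Whenever all derivatives of a function are to be known at once, a candidate family [F] is
    written down and only one differentiation step is checked. *)
Lemma Derive_n_tower (f : R -> R) (F : nat -> R -> R) :
  (forall x, F 0%nat x = f x) ->
  (forall n x, is_derive (F n) x (F (S n) x)) ->
  smooth f /\ forall n x, Derive_n f n x = F n x.
Proof.
  intros H0 HF.
  assert (HD : forall n x, Derive_n f n x = F n x).
  { induction n as [|n IH]; intros x; simpl.
    - now rewrite H0.
    - rewrite (Derive_ext _ (F n)) by exact IH. now apply is_derive_unique. }
  split; [|exact HD].
  intros [|n] x; [exact I|]. simpl.
  apply ex_derive_ext with (F n); [intros t; now rewrite HD|].
  now exists (F (S n) x).
Qed.

Lemma mean_value (f df : R -> R) (x y : R) :
  (forall z, is_derive f z (df z)) ->
  exists c, Rmin x y <= c <= Rmax x y /\ f y - f x = df c * (y - x).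
Proof.
  intros H. apply (MVT_gen f x y df).
  - intros z _. apply H.
  - intros z _. apply continuity_pt_filterlim.
    apply (ex_derive_continuous (V := R_NormedModule) f z). now exists (df z).
Qed.

Lemma mean_value_le (f df : R -> R) (B x y : R) :
  (forall z, is_derive f z (df z)) ->
  (forall z, Rabs (df z) <= B) ->
  Rabs (f y - f x) <= B * Rabs (y - x).
Proof.
  intros H HB. destruct (mean_value f df x y H) as [c [_ ->]].
  rewrite Rabs_mult. apply Rmult_le_compat_r; [apply Rabs_pos|apply HB].
Qed.

Lemma abs_between (x y c : R) :
  Rmin x y <= c <= Rmax x y -> Rabs (c - x) <= Rabs (y - x).
Proof.
  unfold Rmin, Rmax. destruct (Rle_dec x y); intros; unfold Rabs;
  destruct (Rcase_abs (c - x)), (Rcase_abs (y - x)); lra.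
Qed.

(** The mean value theorem is applied twice; the factor 1/2 of Taylor's formula is given up. *)
Lemma taylor2_le (f df ddf : R -> R) (B x y : R) :
  (forall z, is_derive f z (df z)) ->
  (forall z, is_derive df z (ddf z)) ->
  (forall z, Rabs (ddf z) <= B) ->
  Rabs (f y - f x - df x * (y - x)) <= B * (y - x) ^ 2.
Proof.
  intros H H' HB. destruct (mean_value f df x y H) as [c [Hc E]].
  rewrite E. replace (df c * (y - x) - df x * (y - x)) with ((df c - df x) * (y - x)) by ring.
  rewrite Rabs_mult, <- Rsqr_pow2, Rsqr_abs. unfold Rsqr.
  rewrite <- Rmult_assoc. apply Rmult_le_compat_r; [apply Rabs_pos|].
  apply Rle_trans with (B * Rabs (c - x)).
  - now apply mean_value_le with ddf.
  - apply Rmult_le_compat_l; [|now apply abs_between].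
    apply Rle_trans with (1 := Rabs_pos (ddf 0)), HB.
Qed.

(** A quadratic remainder is an inequality between numbers, so it can be summed over a series; this
    is what termwise differentiation rests on. *)
Lemma is_derive_quadratic (f : R -> R) (l K x : R) :
  (forall y, Rabs (f y - f x - l * (y - x)) <= K * (y - x) ^ 2) ->
  is_derive f x l.
Proof.
  intros H. apply is_derive_Reals. intros eps Heps.
  assert (HK : 0 < Rabs K + 1) by (pose proof (Rabs_pos K); lra).
  exists (mkposreal _ (Rdiv_lt_0_compat _ _ Heps HK)). simpl.
  intros h Hh Hd.
  replace ((f (x + h) - f x) / h - l) with ((f (x + h) - f x - l * h) / h)
    by (field; exact Hh).
  unfold Rdiv at 1. rewrite Rabs_mult, Rabs_inv.
  specialize (H (x + h)). replace (x + h - x) with h in H by ring.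
  assert (Hp : 0 < Rabs h) by now apply Rabs_pos_lt.
  apply Rmult_lt_reg_r with (Rabs h); [exact Hp|].
  rewrite Rmult_assoc, Rinv_l, Rmult_1_r by lra.
  apply Rle_lt_trans with (1 := H).
  replace (h ^ 2) with (Rabs h * Rabs h) by (rewrite <- Rsqr_pow2, Rsqr_abs; reflexivity).
  rewrite <- Rmult_assoc. apply Rmult_lt_compat_r; [exact Hp|].
  apply Rle_lt_trans with ((Rabs K + 1) * Rabs h).
  - apply Rmult_le_compat_r; [lra|]. pose proof (Rle_abs K). lra.
  - apply Rmult_lt_reg_r with (/ (Rabs K + 1)); [now apply Rinv_0_lt_compat|].
    replace ((Rabs K + 1) * Rabs h * / (Rabs K + 1)) with (Rabs h) by (field; lra).
    exact Hd.
Qed.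

(** * Series of functions *)

Lemma ex_series_nonneg_bounded (a : nat -> R) (B : R) :
  (forall n, 0 <= a n) -> (forall n, sum_n a n <= B) ->
  ex_series a /\ Series a <= B.
Proof.
  intros Ha HB.
  assert (Hex : ex_series a).
  { destruct (ex_finite_lim_seq_incr (sum_n a) B) as [l Hl]; [|exact HB|].
    - intros n. rewrite sum_Sn. unfold plus; simpl. specialize (Ha (S n)). lra.
    - exists l. exact Hl. }
  split; [exact Hex|].
  apply (is_lim_seq_le (sum_n a) (fun _ => B) (Series a) B HB).
  - apply Series_correct, Hex.
  - apply is_lim_seq_const.
Qed.

Lemma sum_n_le_Series (a : nat -> R) (n : nat) :
  (forall n, 0 <= a n) -> ex_series a -> sum_n a n <= Series a.
Proof.
  intros Ha Hex.
  apply (is_lim_seq_incr_compare (sum_n a)).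
  - apply Series_correct, Hex.
  - intros m. rewrite sum_Sn. unfold plus; simpl. specialize (Ha (S m)). lra.
Qed.

Lemma ex_series_abs_le (a b : nat -> R) :
  (forall n, Rabs (a n) <= b n) -> ex_series b -> ex_series a.
Proof. intros H Hb. exact (ex_series_le a b H Hb). Qed.

Lemma Series_abs_le (a b : nat -> R) :
  (forall n, Rabs (a n) <= b n) -> ex_series b -> Rabs (Series a) <= Series b.
Proof.
  intros H Hb.
  assert (Ha : ex_series (fun n => Rabs (a n))).
  { apply ex_series_abs_le with b; [|exact Hb].
    intros n. now rewrite Rabs_Rabsolu. }
  apply Rle_trans with (1 := Series_Rabs a Ha).
  apply Series_le; [|exact Hb].
  intros n. split; [apply Rabs_pos|apply H].
Qed.

(** The second-order remainders of the terms add up to at most [Series c2] times the squared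
    increment. Summable bounds on second derivatives thus replace an argument by uniform
    convergence. *)
Lemma is_derive_Series (g dg ddg : nat -> R -> R) (c0 c1 c2 : nat -> R) (x : R) :
  (forall k z, is_derive (g k) z (dg k z)) ->
  (forall k z, is_derive (dg k) z (ddg k z)) ->
  (forall k z, Rabs (g k z) <= c0 k) ->
  (forall k z, Rabs (dg k z) <= c1 k) ->
  (forall k z, Rabs (ddg k z) <= c2 k) ->
  ex_series c0 -> ex_series c1 -> ex_series c2 ->
  is_derive (fun z => Series (fun k => g k z)) x (Series (fun k => dg k x)).
Proof.
  intros Hg Hdg H0 H1 H2 E0 E1 E2.
  assert (Sg : forall z, ex_series (fun k => g k z))
    by (intros z; now apply ex_series_abs_le with c0).
  assert (Sdg : ex_series (fun k => dg k x)) by now apply ex_series_abs_le with c1.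
  apply is_derive_quadratic with (Series c2). intros y.
  rewrite <- Series_minus by apply Sg.
  replace (Series (fun k => dg k x) * (y - x)) with (Series (fun k => (y - x) * dg k x))
    by (rewrite Series_scal_l; ring).
  rewrite <- Series_minus; [|now apply (ex_series_minus (fun k => g k y))|
                            exact (ex_series_scal (V := R_NormedModule) (y - x) _ Sdg)].
  rewrite <- Series_scal_r.
  apply Series_abs_le; [|now apply ex_series_scal_r].
  intros k. rewrite (Rmult_comm (y - x)). now apply taylor2_le with (ddg k).
Qed.

Lemma smooth_Series (F : nat -> R -> R) (c : nat -> nat -> R) :
  (forall k, smooth (F k)) ->
  (forall n k x, Rabs (Derive_n (F k) n x) <= c n k) ->
  (forall n, ex_series (c n)) ->
  smooth (fun x => Series (fun k => F k x)) /\
  forall n x, Derive_n (fun x => Series (fun k => F k x)) n x =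
              Series (fun k => Derive_n (F k) n x).
Proof.
  intros HF Hc Hex.
  apply (Derive_n_tower _ (fun n x => Series (fun k => Derive_n (F k) n x))).
  - reflexivity.
  - intros n x.
    apply (is_derive_Series (fun k => Derive_n (F k) n) (fun k => Derive_n (F k) (S n))
             (fun k => Derive_n (F k) (S (S n))) (c n) (c (S n)) (c (S (S n))));
      try apply Hex; try (intros; apply Hc); intros k z; now apply is_derive_Derive_n.
Qed.

Lemma smooth_linear (f g : R -> R) (a b : R) :
  smooth f -> smooth g ->
  smooth (fun x => a * f x + b * g x) /\
  forall n x, Derive_n (fun x => a * f x + b * g x) n x =
              a * Derive_n f n x + b * Derive_n g n x.
Proof.
  intros Hf Hg.
  apply (Derive_n_tower _ (fun n x => a * Derive_n f n x + b * Derive_n g n x)).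
  - reflexivity.
  - intros n x.
    apply (is_derive_plus (fun x => a * Derive_n f n x) (fun x => b * Derive_n g n x));
      apply is_derive_scal; now apply is_derive_Derive_n.
Qed.

Lemma Derive_n_vanish_outside (f : R -> R) (B : R) (n : nat) (x : R) :
  (forall y, B < Rabs y -> f y = 0) -> B < Rabs x -> Derive_n f n x = 0.
Proof.
  intros Hf Hx.
  rewrite (Derive_n_ext_loc f (fun _ => 0)).
  - destruct n; [reflexivity|apply Derive_n_const].
  - assert (He : 0 < Rabs x - B) by lra.
    exists (mkposreal _ He). intros y Hy. apply Hf.
    change (Rabs (y - x) < Rabs x - B) in Hy. revert Hy. split_Rabs; lra.
Qed.

(* The mean value theorem between [x] and a point of (1, 2], where all the derivatives vanish. *)
Lemma Derive_n_le_higher (f : R -> R) (B : R) (n d : nat) :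
  smooth f -> (forall y, 1 < Rabs y -> f y = 0) ->
  (forall x, Rabs (Derive_n f (n + d) x) <= B) ->
  forall x, Rabs (Derive_n f n x) <= 3 ^ d * B.
Proof.
  intros Hs Hf. revert n B. induction d as [|d IH]; intros n B HB x.
  - rewrite Nat.add_0_r in HB. simpl. rewrite Rmult_1_l. apply HB.
  - assert (H1 : forall x, Rabs (Derive_n f (S n) x) <= 3 ^ d * B).
    { apply IH. intros y. replace (S n + d)%nat with (n + S d)%nat by lia. apply HB. }
    destruct (Rlt_le_dec 1 (Rabs x)) as [Hx|Hx].
    + rewrite (Derive_n_vanish_outside f 1) by assumption. rewrite Rabs_R0.
      apply Rmult_le_pos; [apply pow_le; lra|].
      apply Rle_trans with (1 := Rabs_pos (Derive_n f (n + S d) 0)), HB.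
    + pose proof (mean_value_le (Derive_n f n) (Derive_n f (S n)) _ 2 x
        (fun z => is_derive_Derive_n f n z Hs) H1) as H.
      rewrite (Derive_n_vanish_outside f 1 n 2) in H; [|exact Hf|rewrite Rabs_pos_eq; lra].
      rewrite Rminus_0_r in H. apply Rle_trans with (1 := H).
      assert (0 <= 3 ^ d * B) by (apply Rle_trans with (1 := Rabs_pos (Derive_n f (S n) 0)), H1).
      assert (Rabs (x - 2) <= 3) by (apply Rabs_le_between in Hx; apply Rabs_le; lra).
      simpl. nra.
Qed.

(** * Smooth cutoffs by iterated averages *)

(** The class in which the averages are taken: it ensures integrability, [avg] preserves the
    constant L, and one average of half-width h moves the function by at most L * h. *)
Definition lipschitz (L : R) (f : R -> R) : Prop :=
  forall x y, Rabs (f y - f x) <= L * Rabs (y - x).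

Definition avg (h : R) (f : R -> R) (x : R) : R := RInt f (x - h) (x + h) / (2 * h).

(** The derivative of [avg h f]: each average buys one derivative at the price of a factor 1/h. *)
Definition cdiff (h : R) (f : R -> R) (x : R) : R := (f (x + h) - f (x - h)) / (2 * h).

Lemma lipschitz_nonneg (L : R) (f : R -> R) : lipschitz L f -> 0 <= L.
Proof.
  intros H. specialize (H 0 1). rewrite Rminus_0_r, Rabs_R1, Rmult_1_r in H.
  apply Rle_trans with (1 := Rabs_pos _) (2 := H).
Qed.

Lemma lipschitz_continuous (L : R) (f : R -> R) (x : R) :
  lipschitz L f -> continuous f x.
Proof.
  intros H. pose proof (lipschitz_nonneg L f H) as HL.
  apply continuity_pt_filterlim. intros eps Heps.
  exists (eps / (L + 1)). split.
  - apply Rdiv_lt_0_compat; lra.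
  - intros y [_ Hy]. simpl in *. unfold Rdist in *.
    apply Rle_lt_trans with (1 := H x y).
    apply Rle_lt_trans with ((L + 1) * Rabs (y - x)).
    + apply Rmult_le_compat_r; [apply Rabs_pos|lra].
    + apply Rmult_lt_reg_r with (/ (L + 1)); [apply Rinv_0_lt_compat; lra|].
      replace ((L + 1) * Rabs (y - x) * / (L + 1)) with (Rabs (y - x)) by (field; lra).
      exact Hy.
Qed.

Lemma lipschitz_ex_RInt (L : R) (f : R -> R) (a b : R) :
  lipschitz L f -> ex_RInt f a b.
Proof.
  intros H. apply (ex_RInt_continuous (V := R_CompleteNormedModule)).
  intros z _. now apply lipschitz_continuous with L.
Qed.

Lemma avg_derive (h L : R) (f : R -> R) (x : R) :
  lipschitz L f -> is_derive (avg h f) x (cdiff h f x).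
Proof.
  intros H.
  assert (HF : forall y, is_derive (RInt f 0) y (f y)).
  { intros y. apply (is_derive_RInt (V := R_CompleteNormedModule) f (RInt f 0) 0).
    - apply filter_forall. intros z. apply (RInt_correct (V := R_CompleteNormedModule)).
      now apply lipschitz_ex_RInt with L.
    - now apply lipschitz_continuous with L. }
  apply is_derive_ext with (fun y => / (2 * h) * (RInt f 0 (y + h) - RInt f 0 (y - h))).
  - intros y. unfold avg, Rdiv. rewrite (Rmult_comm (RInt _ _ _)). f_equal.
    pose proof (RInt_Chasles f 0 (y - h) (y + h) (lipschitz_ex_RInt L f _ _ H)
                  (lipschitz_ex_RInt L f _ _ H)) as E.
    unfold plus in E; simpl in E. unfold Rminus in *. lra.
  - unfold cdiff, Rdiv. rewrite (Rmult_comm (_ - _)). apply is_derive_scal.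
    apply (is_derive_minus (fun y => RInt f 0 (y + h)) (fun y => RInt f 0 (y - h))).
    + replace (f (x + h)) with (1 * f (x + h)) by ring.
      apply (is_derive_comp (RInt f 0) (fun y => y + h)); [apply HF|].
      auto_derive; [exact I|ring].
    + replace (f (x - h)) with (1 * f (x - h)) by ring.
      apply (is_derive_comp (RInt f 0) (fun y => y - h)); [apply HF|].
      auto_derive; [exact I|ring].
Qed.

Lemma avg_const (h c : R) (f : R -> R) (x : R) :
  0 < h -> (forall y, Rabs (y - x) <= h -> f y = c) -> avg h f x = c.
Proof.
  intros Hh Hf. unfold avg.
  rewrite (RInt_ext f (fun _ => c)).
  - rewrite RInt_const. unfold scal; simpl; unfold mult; simpl. field. lra.
  - intros y. rewrite Rmin_left, Rmax_right by lra. intros Hy.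
    apply Hf, Rabs_le. lra.
Qed.

Lemma avg_close (h B L L' : R) (f g : R -> R) (x : R) :
  0 < h -> lipschitz L f -> lipschitz L' g ->
  (forall y, Rabs (y - x) <= h -> Rabs (f y - g y) <= B) ->
  Rabs (avg h f x - avg h g x) <= B.
Proof.
  intros Hh Hf Hg HB. unfold avg.
  replace (RInt f (x - h) (x + h) / (2 * h) - RInt g (x - h) (x + h) / (2 * h))
    with (RInt (fun y => f y - g y) (x - h) (x + h) * / (2 * h)).
  2:{ rewrite (RInt_minus f g); try now (eapply lipschitz_ex_RInt; eassumption).
      unfold minus, plus, opp; simpl. field. lra. }
  rewrite Rabs_mult, (Rabs_pos_eq (/ (2 * h))) by (apply Rlt_le, Rinv_0_lt_compat; lra).
  apply Rmult_le_reg_r with (2 * h); [lra|].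
  rewrite Rmult_assoc, Rinv_l, Rmult_1_r by lra.
  replace (B * (2 * h)) with ((x + h - (x - h)) * B) by ring.
  apply abs_RInt_le_const; [lra| |].
  - apply (ex_RInt_minus f g); eapply lipschitz_ex_RInt; eassumption.
  - intros y Hy. apply HB, Rabs_le. lra.
Qed.

Lemma lipschitz_const (c : R) : lipschitz 0 (fun _ => c).
Proof. intros x y. rewrite Rminus_diag, Rabs_R0. lra. Qed.

Lemma cdiff_lipschitz_le (h L : R) (f : R -> R) (x : R) :
  0 < h -> lipschitz L f -> Rabs (cdiff h f x) <= L.
Proof.
  intros Hh Hf. unfold cdiff, Rdiv.
  rewrite Rabs_mult, (Rabs_pos_eq (/ (2 * h))) by (apply Rlt_le, Rinv_0_lt_compat; lra).
  apply Rmult_le_reg_r with (2 * h); [lra|].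
  rewrite Rmult_assoc, Rinv_l, Rmult_1_r by lra.
  apply Rle_trans with (1 := Hf (x - h) (x + h)).
  replace (x + h - (x - h)) with (2 * h) by ring. rewrite Rabs_pos_eq by lra. lra.
Qed.

Lemma cdiff_le (h B : R) (f : R -> R) (x : R) :
  0 < h -> (forall y, Rabs (f y) <= B) -> Rabs (cdiff h f x) <= / h * B.
Proof.
  intros Hh HB. unfold cdiff, Rdiv.
  rewrite Rabs_mult, (Rabs_pos_eq (/ (2 * h))) by (apply Rlt_le, Rinv_0_lt_compat; lra).
  apply Rle_trans with (2 * B * / (2 * h)).
  - apply Rmult_le_compat_r; [apply Rlt_le, Rinv_0_lt_compat; lra|].
    pose proof (HB (x + h)). pose proof (HB (x - h)).
    pose proof (Rabs_triang (f (x + h)) (- f (x - h))).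
    rewrite Rabs_Ropp in *. unfold Rminus in *. lra.
  - apply Req_le. field. lra.
Qed.

Lemma cdiff_derive (h : R) (f df : R -> R) (x : R) :
  (forall y, is_derive f y (df y)) -> is_derive (cdiff h f) x (cdiff h df x).
Proof.
  intros H. unfold cdiff.
  apply is_derive_ext with (fun y => / (2 * h) * (f (y + h) - f (y - h))).
  - intros y. unfold Rdiv. apply Rmult_comm.
  - unfold Rdiv. rewrite (Rmult_comm (_ - _)). apply is_derive_scal.
    apply (is_derive_minus (fun y => f (y + h)) (fun y => f (y - h))).
    + replace (df (x + h)) with (1 * df (x + h)) by ring.
      apply (is_derive_comp f (fun y => y + h)); [apply H|]. auto_derive; [exact I|ring].
    + replace (df (x - h)) with (1 * df (x - h)) by ring.
      apply (is_derive_comp f (fun y => y - h)); [apply H|]. auto_derive; [exact I|ring].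
Qed.

Lemma avg_lipschitz (h L : R) (f : R -> R) :
  0 < h -> lipschitz L f -> lipschitz L (avg h f).
Proof.
  intros Hh Hf x y. apply mean_value_le with (cdiff h f).
  - intros z. now apply avg_derive with L.
  - intros z. now apply cdiff_lipschitz_le.
Qed.

Lemma avg_near (h L : R) (f : R -> R) (x : R) :
  0 < h -> lipschitz L f -> Rabs (avg h f x - f x) <= L * h.
Proof.
  intros Hh Hf. pose proof (lipschitz_nonneg L f Hf).
  rewrite <- (avg_const h (f x) (fun _ => f x) x Hh) by reflexivity.
  apply avg_close with L 0; [exact Hh|exact Hf|apply lipschitz_const|].
  intros y Hy. apply Rle_trans with (1 := Hf x y).
  now apply Rmult_le_compat_l.
Qed.

(** * Iterated averages, their limit and its derivatives *)

(** Start and length are separate arguments, and the recursion peels off the first index, as in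
    [iavg] below. *)
Fixpoint fsum (w : nat -> R) (n k : nat) : R :=
  match k with
  | O => 0
  | S k' => w n + fsum w (S n) k'
  end.

Fixpoint fprod (q : nat -> R) (n k : nat) : R :=
  match k with
  | O => 1
  | S k' => q n * fprod q (S n) k'
  end.

Lemma fsum_add (w : nat -> R) (n j k : nat) :
  fsum w n (j + k) = fsum w n j + fsum w (n + j) k.
Proof.
  revert n. induction j as [|j IH]; intros n; simpl.
  - rewrite Nat.add_0_r. ring.
  - rewrite IH. replace (n + S j)%nat with (S n + j)%nat by lia. simpl. ring.
Qed.

Lemma fsum_nonneg (w : nat -> R) (n k : nat) : (forall i, 0 < w i) -> 0 <= fsum w n k.
Proof.
  intros Hw. revert n. induction k as [|k IH]; intros n; simpl; [lra|].
  specialize (IH (S n)). specialize (Hw n). lra.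
Qed.

Lemma fsum_tail_le (w : nat -> R) (G : R) (n k : nat) :
  (forall i, 0 < w i) -> (forall k, fsum w 0 k <= G) -> fsum w n k <= G.
Proof.
  intros Hw HG. pose proof (HG (n + k)%nat) as H.
  rewrite fsum_add in H. simpl in H. pose proof (fsum_nonneg w 0 n Hw). lra.
Qed.

Lemma fprod_add (w : nat -> R) (n j k : nat) :
  fprod w n (j + k) = fprod w n j * fprod w (n + j) k.
Proof.
  revert n. induction j as [|j IH]; intros n; simpl.
  - rewrite Nat.add_0_r. ring.
  - rewrite IH. replace (n + S j)%nat with (S n + j)%nat by lia. simpl. ring.
Qed.

Lemma fprod_pos (w : nat -> R) (n k : nat) : (forall i, 0 < w i) -> 0 < fprod w n k.
Proof.
  intros Hw. revert n. induction k as [|k IH]; intros n; simpl; [lra|].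
  now apply Rmult_lt_0_compat.
Qed.

(** Index n is outermost. Differentiation strips averages from the outside, whereas passing from k
    to k + 1 inserts a new one next to [u]. *)
Fixpoint iavg (w : nat -> R) (u : R -> R) (n k : nat) : R -> R :=
  match k with
  | O => u
  | S k' => avg (w n) (iavg w u (S n) k')
  end.

Lemma iavg_lipschitz (w : nat -> R) (u : R -> R) (L : R) (n k : nat) :
  (forall i, 0 < w i) -> lipschitz L u -> lipschitz L (iavg w u n k).
Proof.
  intros Hw Hu. revert n. induction k as [|k IH]; intros n; simpl; [exact Hu|].
  now apply avg_lipschitz.
Qed.

(** The averages see [u] only within their total half-width. This yields both the plateau and the
    support of the cutoff. *)
Lemma iavg_const (w : nat -> R) (u : R -> R) (n k : nat) (c x : R) :
  (forall i, 0 < w i) ->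
  (forall y, Rabs (y - x) <= fsum w n k -> u y = c) -> iavg w u n k x = c.
Proof.
  intros Hw. revert n x. induction k as [|k IH]; intros n x Hu; simpl in *.
  - apply Hu. rewrite Rminus_diag, Rabs_R0. lra.
  - apply avg_const; [apply Hw|]. intros y Hy. apply IH. intros z Hz.
    apply Hu. replace (z - x) with ((z - y) + (y - x)) by ring.
    apply Rle_trans with (1 := Rabs_triang _ _). lra.
Qed.

Lemma iavg_bounded (w : nat -> R) (u : R -> R) (L B : R) (n k : nat) (x : R) :
  (forall i, 0 < w i) -> lipschitz L u -> (forall y, Rabs (u y) <= B) ->
  Rabs (iavg w u n k x) <= B.
Proof.
  intros Hw Hu HB. revert n x. induction k as [|k IH]; intros n x; simpl; [apply HB|].
  rewrite <- (Rminus_0_r (avg _ _ _)).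
  rewrite <- (avg_const (w n) 0 (fun _ => 0) x (Hw n)) by reflexivity.
  apply avg_close with L 0; [apply Hw|now apply iavg_lipschitz|apply lipschitz_const|].
  intros y _. rewrite Rminus_0_r. apply IH.
Qed.

(** The d additional averages are the innermost ones: they move [u] by at most L times their total
    half-width, and the k outer averages do not increase the sup distance. *)
Lemma iavg_cauchy (w : nat -> R) (u : R -> R) (L : R) (n k d : nat) (x : R) :
  (forall i, 0 < w i) -> lipschitz L u ->
  Rabs (iavg w u n (k + d) x - iavg w u n k x) <= L * fsum w (n + k) d.
Proof.
  intros Hw Hu. pose proof (lipschitz_nonneg L u Hu) as HL.
  revert n x. induction k as [|k IH]; intros n x; simpl.
  - rewrite Nat.add_0_r. revert n x. induction d as [|d IHd]; intros n x; simpl.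
    + rewrite Rminus_diag, Rabs_R0. lra.
    + replace (avg (w n) (iavg w u (S n) d) x - u x) with
        ((avg (w n) (iavg w u (S n) d) x - avg (w n) u x) + (avg (w n) u x - u x)) by ring.
      apply Rle_trans with (1 := Rabs_triang _ _).
      rewrite Rmult_plus_distr_l, Rplus_comm. apply Rplus_le_compat.
      * now apply avg_near.
      * apply avg_close with L L; auto using iavg_lipschitz.
  - apply avg_close with L L; auto using iavg_lipschitz.
    intros y _. replace (n + S k)%nat with (S n + k)%nat by lia. apply IH.
Qed.

Definition iavg_lim (w : nat -> R) (u : R -> R) (n : nat) (x : R) : R :=
  real (Lim_seq (fun k => iavg w u n k x)).

Lemma fsum_small_tail (w : nat -> R) (G : R) (n : nat) (eps : R) :
  (forall i, 0 < w i) -> (forall k, fsum w 0 k <= G) -> 0 < eps ->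
  exists k0, forall k d, (k0 <= k)%nat -> fsum w (n + k) d < eps.
Proof.
  intros Hw HG Heps.
  destruct (ex_finite_lim_seq_incr (fsum w n) G) as [l Hl].
  - intros k. replace (S k) with (k + 1)%nat by lia. rewrite fsum_add. simpl.
    pose proof (Hw (n + k)%nat). lra.
  - intros k. now apply fsum_tail_le.
  - apply is_lim_seq_spec in Hl. assert (He : 0 < eps / 2) by lra.
    destruct (Hl (mkposreal _ He)) as [k0 Hk0]. simpl in Hk0.
    exists k0. intros k d Hk.
    pose proof (Hk0 k Hk) as H1. pose proof (Hk0 (k + d)%nat ltac:(lia)) as H2.
    rewrite fsum_add in H2. apply Rabs_def2 in H1, H2. lra.
Qed.

Lemma iavg_lim_correct (w : nat -> R) (u : R -> R) (L G : R) (n : nat) (x : R) :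
  (forall i, 0 < w i) -> (forall k, fsum w 0 k <= G) -> lipschitz L u ->
  is_lim_seq (fun k => iavg w u n k x) (iavg_lim w u n x).
Proof.
  intros Hw HG Hu. pose proof (lipschitz_nonneg L u Hu) as HL.
  apply Lim_seq_correct', ex_lim_seq_cauchy_corr. intros eps.
  assert (He : 0 < eps / (L + 1)) by (apply Rdiv_lt_0_compat; [apply cond_pos|lra]).
  destruct (fsum_small_tail w G n _ Hw HG He) as [k0 Hk0].
  assert (Hc : forall k d, (k0 <= k)%nat ->
            Rabs (iavg w u n (k + d) x - iavg w u n k x) < eps).
  { intros k d Hk. apply Rle_lt_trans with (1 := iavg_cauchy w u L n k d x Hw Hu).
    pose proof (fsum_nonneg w (n + k) d Hw).
    apply Rle_lt_trans with ((L + 1) * fsum w (n + k) d); [nra|].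
    replace (pos eps) with ((L + 1) * (eps / (L + 1))) by (field; lra).
    apply Rmult_lt_compat_l; [lra|now apply Hk0]. }
  exists k0. intros k k' Hk Hk'.
  destruct (Nat.le_ge_cases k k').
  - rewrite Rabs_minus_sym. replace k' with (k + (k' - k))%nat by lia. now apply Hc.
  - replace k with (k' + (k - k'))%nat by lia. now apply Hc.
Qed.

Lemma is_lim_seq_abs_le (a : nat -> R) (l c B : R) :
  is_lim_seq a l -> eventually (fun n => Rabs (a n - c) <= B) -> Rabs (l - c) <= B.
Proof.
  intros Ha [N HN].
  assert (Hl : is_lim_seq (fun n => Rabs (a n - c)) (Rabs (l - c))).
  { apply (is_lim_seq_abs _ (l - c)). apply is_lim_seq_minus'; [exact Ha|apply is_lim_seq_const]. }
  apply (is_lim_seq_le_loc (fun n => Rabs (a n - c)) (fun _ => B) (Rabs (l - c)) B).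
  - now exists N.
  - exact Hl.
  - apply is_lim_seq_const.
Qed.

Lemma iavg_lim_lipschitz (w : nat -> R) (u : R -> R) (L G : R) (n : nat) :
  (forall i, 0 < w i) -> (forall k, fsum w 0 k <= G) -> lipschitz L u ->
  lipschitz L (iavg_lim w u n).
Proof.
  intros Hw HG Hu x y.
  rewrite <- (Rminus_0_r (_ - _)).
  apply is_lim_seq_abs_le with (fun k => iavg w u n k y - iavg w u n k x).
  - apply is_lim_seq_minus'; now apply iavg_lim_correct with L G.
  - exists 0%nat. intros k _. rewrite Rminus_0_r.
    now apply (iavg_lipschitz w u L n k Hw Hu).
Qed.

(** The Cauchy estimate is uniform in the point, so the limit passes under the outermost average.
    The limit is therefore an average of a function of the same kind, which can be differentiated
    again and again. *)
Lemma iavg_lim_avg (w : nat -> R) (u : R -> R) (L G : R) (n : nat) (x : R) :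
  (forall i, 0 < w i) -> (forall k, fsum w 0 k <= G) -> lipschitz L u ->
  iavg_lim w u n x = avg (w n) (iavg_lim w u (S n)) x.
Proof.
  intros Hw HG Hu. pose proof (lipschitz_nonneg L u Hu) as HL.
  apply Rminus_diag_uniq. apply cond_eq. intros eps Heps.
  assert (He : 0 < eps / (L + 1) / 2) by (repeat apply Rdiv_lt_0_compat; lra).
  destruct (fsum_small_tail w G (S n) _ Hw HG He) as [k0 Hk0].
  apply Rle_lt_trans with (eps / 2); [|lra].
  rewrite Rminus_0_r.
  apply is_lim_seq_abs_le with (fun k => iavg w u n (S k) x).
  - apply (is_lim_seq_incr_1 (fun k => iavg w u n k x)). now apply iavg_lim_correct with L G.
  - exists k0. intros k Hk. simpl.
    apply avg_close with L L; auto using iavg_lipschitz.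
    { now apply iavg_lim_lipschitz with G. }
    intros y _. rewrite Rabs_minus_sym.
    apply is_lim_seq_abs_le with (fun j => iavg w u (S n) j y).
    + now apply iavg_lim_correct with L G.
    + exists k. intros j Hj. replace j with (k + (j - k))%nat by lia.
      apply Rle_trans with (1 := iavg_cauchy w u L (S n) k (j - k) y Hw Hu).
      pose proof (fsum_nonneg w (S n + k) (j - k) Hw).
      pose proof (Hk0 k (j - k)%nat Hk).
      apply Rle_trans with ((L + 1) * (eps / (L + 1) / 2)); [nra|].
      apply Req_le. field. lra.
Qed.

(** The m-th derivative of [iavg_lim w u n]: the m outermost averages have become difference
    quotients. *)
Fixpoint cutoff_tower (w : nat -> R) (u : R -> R) (n m : nat) : R -> R :=
  match m with
  | O => iavg_lim w u n
  | S m' => cdiff (w n) (cutoff_tower w u (S n) m')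
  end.

Lemma cutoff_tower_derive (w : nat -> R) (u : R -> R) (L G : R) (n m : nat) (x : R) :
  (forall i, 0 < w i) -> (forall k, fsum w 0 k <= G) -> lipschitz L u ->
  is_derive (cutoff_tower w u n m) x (cutoff_tower w u n (S m) x).
Proof.
  intros Hw HG Hu. revert n x. induction m as [|m IH]; intros n x.
  - simpl. apply is_derive_ext with (avg (w n) (iavg_lim w u (S n))).
    + intros y. symmetry. now apply iavg_lim_avg with L G.
    + apply avg_derive with L. now apply iavg_lim_lipschitz with G.
  - apply (cdiff_derive (w n) (cutoff_tower w u (S n) m)). intros y. apply IH.
Qed.

Lemma cutoff_tower_le (w : nat -> R) (u : R -> R) (L G : R) (n m : nat) (x : R) :
  (forall i, 0 < w i) -> (forall k, fsum w 0 k <= G) -> lipschitz L u ->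
  (forall y, Rabs (u y) <= 1) ->
  Rabs (cutoff_tower w u n m x) <= fprod (fun i => / w i) n m.
Proof.
  intros Hw HG Hu H1. revert n x. induction m as [|m IH]; intros n x; simpl.
  - rewrite <- (Rminus_0_r (iavg_lim _ _ _ _)).
    apply is_lim_seq_abs_le with (fun k => iavg w u n k x).
    + now apply iavg_lim_correct with L G.
    + exists 0%nat. intros k _. rewrite Rminus_0_r. now apply iavg_bounded with L.
  - apply cdiff_le; [apply Hw|]. intros y. apply IH.
Qed.

Lemma trapezoid_lipschitz (G : R) :
  0 < G -> lipschitz (/ G) (fun x => Rmax 0 (Rmin 1 (3 - Rabs x / G))).
Proof.
  intros HG x y.
  assert (H : Rabs (Rabs y / G - Rabs x / G) <= / G * Rabs (y - x)).
  { replace (Rabs y / G - Rabs x / G) with (/ G * (Rabs y - Rabs x)) by (field; lra).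
    rewrite Rabs_mult, Rabs_pos_eq by (apply Rlt_le, Rinv_0_lt_compat, HG).
    apply Rmult_le_compat_l; [apply Rlt_le, Rinv_0_lt_compat, HG|].
    apply Rabs_triang_inv2. }
  apply Rle_trans with (2 := H).
  unfold Rmax, Rmin. repeat destruct (Rle_dec _ _); split_Rabs; lra.
Qed.

(** The trapezoid is 1 for |x| <= 2 G and 0 for |x| >= 3 G; averages of total half-width at most G
    leave 1 up to G and 0 beyond 4 G. The sequence [q] consists of the reciprocal half-widths. *)
Lemma cutoff_exists (q : nat -> R) (G : R) :
  (forall i, 0 < q i) -> 0 < G -> (forall k, fsum (fun i => / q i) 0 k <= G) ->
  exists phi, smooth phi /\
    (forall x, Rabs x <= G -> phi x = 1) /\
    (forall x, 4 * G < Rabs x -> phi x = 0) /\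
    (forall m x, Rabs (Derive_n phi m x) <= fprod q 0 m).
Proof.
  intros Hq HG0 HG.
  set (w := fun i => / q i) in *.
  assert (Hw : forall i, 0 < w i) by (intros i; apply Rinv_0_lt_compat, Hq).
  set (u := fun x => Rmax 0 (Rmin 1 (3 - Rabs x / G))).
  assert (Hu : lipschitz (/ G) u) by now apply trapezoid_lipschitz.
  assert (Hc : forall c x, (forall y, Rabs (y - x) <= G -> u y = c) -> iavg_lim w u 0 x = c).
  { intros c x H. apply Rminus_diag_uniq. apply cond_eq. intros eps Heps.
    rewrite Rminus_0_r.
    apply Rle_lt_trans with 0; [|exact Heps].
    apply is_lim_seq_abs_le with (fun k => iavg w u 0 k x).
    - now apply iavg_lim_correct with (/ G) G.
    - exists 0%nat. intros k _. rewrite (iavg_const w u 0 k c x); [|exact Hw|].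
      + rewrite Rminus_diag, Rabs_R0. lra.
      + intros y Hy. apply H. apply Rle_trans with (1 := Hy), HG. }
  destruct (Derive_n_tower (iavg_lim w u 0) (cutoff_tower w u 0)) as [Hs HD].
  { reflexivity. }
  { intros n x. now apply cutoff_tower_derive with (/ G) G. }
  exists (iavg_lim w u 0). split; [exact Hs|]. split; [|split].
  - intros x Hx. apply Hc. intros y Hy. unfold u.
    assert (H2 : Rabs y / G <= 2).
    { apply Rmult_le_reg_r with G; [exact HG0|]. unfold Rdiv.
      rewrite Rmult_assoc, Rinv_l, Rmult_1_r by lra. split_Rabs; lra. }
    rewrite Rmin_left by lra. apply Rmax_right. lra.
  - intros x Hx. apply Hc. intros y Hy. unfold u.
    assert (H2 : 3 <= Rabs y / G).
    { apply Rmult_le_reg_r with G; [exact HG0|]. unfold Rdiv.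
      rewrite Rmult_assoc, Rinv_l, Rmult_1_r by lra. split_Rabs; lra. }
    rewrite Rmin_right by lra. apply Rmax_left. lra.
  - intros m x. rewrite HD.
    apply Rle_trans with (fprod (fun i => / w i) 0 m).
    + apply cutoff_tower_le with (/ G) G; auto.
      intros y. unfold u. unfold Rmax, Rmin.
      repeat destruct (Rle_dec _ _); apply Rabs_le; lra.
    + apply Req_le. generalize 0%nat. induction m as [|m IH]; intros n; simpl; [reflexivity|].
      rewrite IH. unfold w. now rewrite Rinv_inv.
Qed.

(** * Kernels *)

Lemma pow_fact_le_exp (x : R) (n : nat) : 0 <= x -> x ^ n / INR (fact n) <= exp x.
Proof.
  intros Hx. apply Rle_trans with (2 := exp_ge_taylor x n Hx).
  assert (Hpos : forall k, 0 <= x ^ k / INR (fact k)).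
  { intros k. apply Rmult_le_pos; [now apply pow_le|].
    apply Rlt_le, Rinv_0_lt_compat, INR_fact_lt_0. }
  destruct n as [|n]; [simpl; lra|]. rewrite tech5.
  pose proof (cond_pos_sum (fun k => x ^ k / INR (fact k)) n Hpos). lra.
Qed.

Definition monom (k : nat) (x : R) : R := x ^ k / INR (fact k).

Definition dmonom (k : nat) (x : R) : R :=
  match k with O => 0 | S k' => monom k' x end.

Lemma monom_derive (k : nat) (x : R) : is_derive (monom k) x (dmonom k x).
Proof.
  unfold monom. destruct k as [|k].
  - apply is_derive_ext with (fun _ => 1); [intros t; simpl; field|].
    apply (is_derive_const (V := R_NormedModule)).
  - assert (Hf := INR_fact_neq_0 k). assert (Hk : INR (S k) <> 0) by (apply not_0_INR; lia).
    replace (dmonom (S k) x) with (INR (S k) * 1 * x ^ pred (S k) / INR (fact (S k))).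
    + apply is_derive_ext with (fun t => / INR (fact (S k)) * t ^ S k).
      * intros t. unfold Rdiv. apply Rmult_comm.
      * unfold Rdiv. rewrite (Rmult_comm (_ * _ ^ _)).
        apply is_derive_scal. apply (is_derive_pow (fun t => t)). apply (is_derive_id x).
    + unfold dmonom, monom. rewrite fact_simpl, mult_INR. simpl pred. now field.
Qed.

Definition dmonom_n (k n : nat) (x : R) : R :=
  if (n <=? k)%nat then monom (k - n) x else 0.

Lemma monom_Derive_n (k : nat) :
  smooth (monom k) /\ forall n x, Derive_n (monom k) n x = dmonom_n k n x.
Proof.
  apply Derive_n_tower; unfold dmonom_n.
  - intros x. simpl. now rewrite Nat.sub_0_r.
  - intros n x. destruct (Nat.leb_spec (S n) k) as [H|H].
    + rewrite (proj2 (Nat.leb_le n k)) by lia.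
      replace (monom (k - S n) x) with (dmonom (k - n) x).
      { apply monom_derive. }
      replace (k - n)%nat with (S (k - S n)) by lia. reflexivity.
    + destruct (Nat.leb_spec n k) as [H'|H'].
      * replace (k - n)%nat with 0%nat by lia. apply monom_derive.
      * apply (is_derive_const (V := R_NormedModule)).
Qed.

Lemma monom_0 (k : nat) : monom k 0 = if (k =? 0)%nat then 1 else 0.
Proof.
  unfold monom. destruct k as [|k]; simpl; [field|].
  rewrite Rmult_0_l. unfold Rdiv. ring.
Qed.

Lemma monom_Derive_n_0 (k n : nat) :
  Derive_n (monom k) n 0 = if (n =? k)%nat then 1 else 0.
Proof.
  rewrite (proj2 (monom_Derive_n k)). unfold dmonom_n.
  destruct (Nat.leb_spec n k); rewrite ?monom_0;
  destruct (Nat.eqb_spec n k); try destruct (Nat.eqb_spec (k - n) 0); lia || reflexivity.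
Qed.

(* The [n]-th derivative of [monom k * phi^(m)], expanded by the product rule
   without collecting equal terms: it has at most [2 ^ n] of them. *)
Fixpoint leibniz (phi : R -> R) (n k m : nat) (x : R) : R :=
  match n with
  | O => monom k x * Derive_n phi m x
  | S n' =>
      match k with O => 0 | S k' => leibniz phi n' k' m x end + leibniz phi n' k (S m) x
  end.

Lemma leibniz_derive (phi : R -> R) (n k m : nat) (x : R) :
  smooth phi -> is_derive (leibniz phi n k m) x (leibniz phi (S n) k m x).
Proof.
  intros Hs. revert k m x. induction n as [|n IH]; intros k m x.
  - replace (leibniz phi 1 k m x)
      with (dmonom k x * Derive_n phi m x + monom k x * Derive_n phi (S m) x)
      by (destruct k; simpl; ring).
    apply (is_derive_mult (monom k) (Derive_n phi m)).
    + apply monom_derive.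
    + now apply is_derive_Derive_n.
    + intros a b. apply Rmult_comm.
  - destruct k as [|k].
    + apply (is_derive_plus (fun _ => 0) (leibniz phi n 0 (S m))).
      * apply (is_derive_const (V := R_NormedModule)).
      * apply IH.
    + apply (is_derive_plus (leibniz phi n k m) (leibniz phi n (S k) (S m))); apply IH.
Qed.

Lemma leibniz_le (phi : R -> R) (W : R) (n k m : nat) (x : R) :
  0 <= W ->
  (forall i, (i <= n)%nat -> (i <= k)%nat ->
     Rabs (monom (k - i) x * Derive_n phi (m + n - i) x) <= W) ->
  Rabs (leibniz phi n k m x) <= 2 ^ n * W.
Proof.
  intros HW. revert k m. induction n as [|n IH]; intros k m H.
  - simpl. rewrite Rmult_1_l. specialize (H 0%nat ltac:(lia) ltac:(lia)).
    rewrite Nat.sub_0_r, Nat.add_0_r, Nat.sub_0_r in H. exact H.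
  - simpl. apply Rle_trans with (1 := Rabs_triang _ _).
    rewrite Rmult_assoc, <- Rplus_diag. apply Rplus_le_compat.
    + destruct k as [|k].
      * rewrite Rabs_R0. apply Rmult_le_pos; [apply pow_le; lra|exact HW].
      * apply IH. intros i Hi Hk. specialize (H (S i) ltac:(lia) ltac:(lia)).
        replace (m + S n - S i)%nat with (m + n - i)%nat in H by lia. exact H.
    + apply IH. intros i Hi Hk. specialize (H i ltac:(lia) ltac:(lia)).
      replace (m + S n - i)%nat with (S m + n - i)%nat in H by lia. exact H.
Qed.

Lemma monom_mult_Derive_n (phi : R -> R) (k : nat) :
  smooth phi ->
  smooth (fun x => monom k x * phi x) /\
  forall n x, Derive_n (fun x => monom k x * phi x) n x = leibniz phi n k 0 x.
Proof.
  intros Hs. apply (Derive_n_tower _ (fun n => leibniz phi n k 0)).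
  - reflexivity.
  - intros n x. now apply leibniz_derive.
Qed.

Lemma Derive_n_eq_near_0 (f g : R -> R) (d : R) (n : nat) :
  0 < d -> (forall x, Rabs x < d -> f x = g x) -> Derive_n f n 0 = Derive_n g n 0.
Proof.
  intros Hd H. apply Derive_n_ext_loc. exists (mkposreal d Hd). intros y Hy.
  apply H. change (Rabs (y - 0) < d) in Hy. now rewrite Rminus_0_r in Hy.
Qed.

(** * Blocks of r equal widths and the kernel of level p *)

Lemma fsum_blocks (r : nat) (g h : nat -> R) (p K : nat) :
  (forall k i, (p <= k)%nat -> (i < r)%nat -> g (r * k + i)%nat = h k) ->
  fsum g (r * p) (r * K) = INR r * fsum h p K.
Proof.
  revert p. induction K as [|K IH]; intros p H.
  - rewrite Nat.mul_0_r. simpl. ring.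
  - rewrite Nat.mul_succ_r, Nat.add_comm, fsum_add. simpl (fsum h p (S K)).
    replace (r * p + r)%nat with (r * S p)%nat by lia.
    rewrite IH by (intros k i Hk; apply H; lia).
    rewrite Rmult_plus_distr_l. f_equal.
    assert (E : forall n j, (r * p <= n)%nat -> (n + j <= r * p + r)%nat ->
              fsum g n j = INR j * h p).
    { intros n j. revert n. induction j as [|j IHj]; intros n H1 H2; [simpl; ring|].
      cbn [fsum]. rewrite IHj by lia. rewrite S_INR.
      replace n with (r * p + (n - r * p))%nat at 1 by lia. rewrite H by lia. ring. }
    apply E; lia.
Qed.

Lemma fprod_blocks (r : nat) (g h : nat -> R) (p K : nat) :
  (forall k i, (p <= k)%nat -> (i < r)%nat -> g (r * k + i)%nat = h k) ->
  fprod g (r * p) (r * K) = fprod h p K ^ r.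
Proof.
  revert p. induction K as [|K IH]; intros p H.
  - rewrite Nat.mul_0_r. simpl. now rewrite pow1.
  - rewrite Nat.mul_succ_r, Nat.add_comm, fprod_add. simpl (fprod h p (S K)).
    replace (r * p + r)%nat with (r * S p)%nat by lia.
    rewrite IH by (intros k i Hk; apply H; lia).
    rewrite Rpow_mult_distr. f_equal.
    assert (E : forall n j, (r * p <= n)%nat -> (n + j <= r * p + r)%nat ->
              fprod g n j = h p ^ j).
    { intros n j. revert n. induction j as [|j IHj]; intros n H1 H2; [reflexivity|].
      cbn [fprod]. rewrite IHj by lia.
      replace n with (r * p + (n - r * p))%nat at 1 by lia. rewrite H by lia. reflexivity. }
    apply E; lia.
Qed.

Lemma fprod_ge_pow (q : nat -> R) (l : R) (n k : nat) :
  0 <= l -> (forall i, l <= q i) -> l ^ k <= fprod q n k.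
Proof.
  intros Hl H. revert n. induction k as [|k IH]; intros n; simpl; [lra|].
  apply Rmult_le_compat; auto using pow_le.
Qed.

Lemma fprod_const (q : nat -> R) (l : R) (n k : nat) :
  (forall i, (i < n + k)%nat -> q i = l) -> fprod q n k = l ^ k.
Proof.
  revert n. induction k as [|k IH]; intros n H; simpl; [reflexivity|].
  rewrite H, IH by (intros; try apply H; lia). reflexivity.
Qed.

Lemma fprod_scal (q : nat -> R) (c : R) (n k : nat) :
  fprod (fun i => c * q i) n k = c ^ k * fprod q n k.
Proof.
  revert n. induction k as [|k IH]; intros n; simpl; [ring|]. rewrite IH. ring.
Qed.

Lemma fsum_scal (q : nat -> R) (c : R) (n k : nat) :
  fsum (fun i => c * q i) n k = c * fsum q n k.
Proof.
  revert n. induction k as [|k IH]; intros n; simpl; [ring|]. rewrite IH. ring.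
Qed.

Lemma fsum_ext (f g : nat -> R) (n k : nat) :
  (forall i, (n <= i)%nat -> f i = g i) -> fsum f n k = fsum g n k.
Proof.
  revert n. induction k as [|k IH]; intros n H; simpl; [reflexivity|].
  rewrite H by lia. rewrite IH by (intros; apply H; lia). reflexivity.
Qed.

(* Reciprocal widths of the cutoff at level [p]: [r * p] averages of width [1 / l],
   then [r] averages of width [1 / nu k] for each [k > p]. *)
Definition widths (r p : nat) (l : R) (nu : nat -> R) (i : nat) : R :=
  if (i <? r * p)%nat then l else nu (S (i / r)).

Lemma widths_low (r p : nat) (l : R) (nu : nat -> R) (i : nat) :
  (i < r * p)%nat -> widths r p l nu i = l.
Proof. intros H. unfold widths. now rewrite (proj2 (Nat.ltb_lt _ _) H). Qed.

Lemma widths_high (r p k i : nat) (l : R) (nu : nat -> R) :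
  (p <= k)%nat -> (i < r)%nat -> widths r p l nu (r * k + i) = nu (S k).
Proof.
  intros Hk Hi. unfold widths.
  rewrite (proj2 (Nat.ltb_ge _ _)) by nia.
  replace ((r * k + i) / r)%nat with k; [reflexivity|].
  now apply (Nat.div_unique _ _ _ i).
Qed.

Lemma widths_ge (r p : nat) (l : R) (nu : nat -> R) (i : nat) :
  (1 <= r)%nat -> (forall k, (p < k)%nat -> l <= nu k) -> l <= widths r p l nu i.
Proof.
  intros Hr H. unfold widths. destruct (Nat.ltb_spec i (r * p)) as [Hi|Hi]; [lra|].
  apply H. apply Nat.lt_succ_r, Nat.div_le_lower_bound; lia.
Qed.

(** The reciprocals of [widths] add up to at most r (1 + B) p / l. Multiplying [widths] by c = 4 r
    (1 + B) / eps brings this total down to G = eps (p / l) / 4, so that the support radius 4 G is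
    eps p / l; the price is c^m in the m-th derivative. *)
Lemma cutoff_kernel (r p : nat) (l B eps : R) (nu : nat -> R) :
  (1 <= r)%nat -> (1 <= p)%nat -> 0 < l -> 0 <= B -> 0 < eps ->
  (forall k, (p < k)%nat -> l <= nu k) ->
  (forall K, fsum (fun k => / nu (S k)) p K <= B * (INR p / l)) ->
  exists phi d, 0 < d /\ smooth phi /\
    (forall x, Rabs x < d -> phi x = 1) /\
    (forall x, eps * (INR p / l) < Rabs x -> phi x = 0) /\
    (forall m x, Rabs (Derive_n phi m x) <=
       (4 * INR r * (1 + B) / eps) ^ m * fprod (widths r p l nu) 0 m).
Proof.
  intros Hr Hp Hl HB He Hnu Hsum.
  assert (Hr1 : 1 <= INR r) by (apply (le_INR 1); exact Hr).
  assert (Hp1 : 1 <= INR p) by (apply (le_INR 1); exact Hp).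
  assert (Hq : forall i, 0 < widths r p l nu i)
    by (intros i; apply Rlt_le_trans with (1 := Hl); now apply widths_ge).
  set (c := 4 * INR r * (1 + B) / eps).
  assert (Hc : 0 < c) by (unfold c; apply Rdiv_lt_0_compat; [nra|exact He]).
  set (G := eps * (INR p / l) / 4).
  assert (Hpl : 0 < INR p / l) by (apply Rdiv_lt_0_compat; lra).
  assert (HG : 0 < G) by (unfold G; apply Rdiv_lt_0_compat; nra).
  destruct (cutoff_exists (fun i => c * widths r p l nu i) G) as [phi [Hs [H1 [H0 HD]]]].
  - intros i. now apply Rmult_lt_0_compat.
  - exact HG.
  - intros k.
    (* Lengthen the sum to r p + r k terms, so that it consists of whole blocks. *)
    apply Rle_trans with (fsum (fun i => / (c * widths r p l nu i)) 0 (r * p + r * k)).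
    { replace (r * p + r * k)%nat with (k + (r * p + r * k - k))%nat by nia.
      rewrite fsum_add.
      pose proof (fsum_nonneg (fun i => / (c * widths r p l nu i)) (0 + k)
        (r * p + r * k - k)
        (fun i => Rinv_0_lt_compat _ (Rmult_lt_0_compat _ _ Hc (Hq i)))). lra. }
    rewrite (fsum_ext _ (fun i => / c * / widths r p l nu i)).
    2:{ intros i _. apply Rinv_mult. }
    rewrite fsum_scal, fsum_add. simpl (0 + r * p)%nat.
    rewrite (fsum_blocks r _ (fun k => / nu (S k))).
    2:{ intros j i Hj Hi. now rewrite widths_high. }
    assert (E : fsum (fun i => / widths r p l nu i) 0 (r * p) = INR r * (INR p / l)).
    { rewrite <- (Nat.mul_0_r r) at 1.
      assert (E : forall n j, (n + j <= r * p)%nat ->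
        fsum (fun i => / widths r p l nu i) n j = INR j / l).
      { intros n j. revert n. induction j as [|j IHj]; intros n Hj.
        - simpl. unfold Rdiv. ring.
        - cbn [fsum]. rewrite IHj by lia. rewrite widths_low by lia. rewrite S_INR. field. lra. }
      rewrite E by lia. rewrite mult_INR. field. lra. }
    rewrite E. specialize (Hsum k).
    apply Rle_trans with (/ c * (INR r * (INR p / l) + INR r * (B * (INR p / l)))).
    + apply Rmult_le_compat_l; [apply Rlt_le, Rinv_0_lt_compat, Hc|].
      apply Rplus_le_compat_l, Rmult_le_compat_l; lra.
    + apply Req_le. unfold c, G. field. repeat split; lra.
  - exists phi, G. repeat split; auto.
    + intros x Hx. apply H1. lra.
    + intros x Hx. apply H0. unfold G. lra.
    + intros m x. rewrite <- fprod_scal. apply HD.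
Qed.

(** On the support |x| <= eps p / l, the monomial of degree r p - i is at most (eps / l)^(r p - i)
    e^p. The i derivatives it has taken are missing from the cutoff, but every reciprocal width is
    at least l, so l^i times the shorter product is at most the full one. The power of 1 / eps
    depends on n only and goes into the growth constant of the class; eps^(r p) is the gain that
    makes the series over p converge. *)
Lemma kernel_exists (r p : nat) (l B eps : R) (nu : nat -> R) :
  (1 <= r)%nat -> (1 <= p)%nat -> 0 < l -> 0 <= B -> 0 < eps ->
  (forall k, (p < k)%nat -> l <= nu k) ->
  (forall K, fsum (fun k => / nu (S k)) p K <= B * (INR p / l)) ->
  eps * (INR p / l) <= 1 ->
  exists f, smooth f /\ (forall x, 1 < Rabs x -> f x = 0) /\
    (forall n, Derive_n f n 0 = if (n =? r * p)%nat then 1 else 0) /\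
    (forall n x, Rabs (Derive_n f n x) <=
       2 ^ n * (exp (INR p) * eps ^ (r * p) * (4 * INR r * (1 + B) / eps) ^ n *
                (fprod (widths r p l nu) 0 n / l ^ (r * p)))).
Proof.
  intros Hr Hp Hl HB He Hnu Hsum Hsup.
  destruct (cutoff_kernel r p l B eps nu) as [phi [d [Hd [Hs [H1 [H0 HD]]]]]]; auto.
  assert (Hr1 : 1 <= INR r) by (apply (le_INR 1); exact Hr).
  assert (Hp1 : 1 <= INR p) by (apply (le_INR 1); exact Hp).
  assert (Hwl : forall i, l <= widths r p l nu i) by (intros i; now apply widths_ge).
  assert (Hq : forall i, 0 < widths r p l nu i)
    by (intros i; now apply Rlt_le_trans with (1 := Hl)).
  assert (Hpl : 0 < INR p / l) by (apply Rdiv_lt_0_compat; lra).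
  destruct (monom_mult_Derive_n phi (r * p) Hs) as [Hsm HDm].
  exists (fun x => monom (r * p) x * phi x). split; [exact Hsm|]. split; [|split].
  - intros x Hx. rewrite H0 by lra. ring.
  - intros n. rewrite (Derive_n_eq_near_0 _ (monom (r * p)) d n Hd).
    + apply monom_Derive_n_0.
    + intros x Hx. rewrite H1 by exact Hx. ring.
  - intros n x. rewrite HDm.
    set (c := 4 * INR r * (1 + B)).
    assert (Hc : 1 <= c) by (unfold c; nra).
    assert (Hce : 0 < c / eps) by (apply Rdiv_lt_0_compat; lra).
    assert (HW : 0 <= exp (INR p) * eps ^ (r * p) * (c / eps) ^ n *
                (fprod (widths r p l nu) 0 n / l ^ (r * p))).
    { repeat apply Rmult_le_pos; try (apply pow_le; lra); try (apply Rlt_le, exp_pos).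
      - now apply Rlt_le, fprod_pos.
      - apply Rlt_le, Rinv_0_lt_compat, pow_lt, Hl. }
    apply leibniz_le; [exact HW|].
    intros i Hin Hip. simpl (0 + n - i)%nat.
    destruct (Rlt_le_dec (eps * (INR p / l)) (Rabs x)) as [Hx|Hx].
    { rewrite (Derive_n_vanish_outside phi _ _ x H0 Hx), Rmult_0_r, Rabs_R0. exact HW. }
    rewrite Rabs_mult.
    apply Rle_trans with ((eps / l) ^ (r * p - i) * exp (INR p) *
       ((c / eps) ^ (n - i) * fprod (widths r p l nu) 0 (n - i))).
    + apply Rmult_le_compat; try apply Rabs_pos; [|apply HD].
      unfold monom, Rdiv at 1. rewrite Rabs_mult, <- RPow_abs.
      rewrite (Rabs_pos_eq (/ _)) by apply Rlt_le, Rinv_0_lt_compat, INR_fact_lt_0.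
      apply Rle_trans with ((eps * (INR p / l)) ^ (r * p - i) * / INR (fact (r * p - i))).
      * apply Rmult_le_compat_r; [apply Rlt_le, Rinv_0_lt_compat, INR_fact_lt_0|].
        apply pow_incr. split; [apply Rabs_pos|exact Hx].
      * replace (eps * (INR p / l)) with (eps / l * INR p) by (field; lra).
        rewrite Rpow_mult_distr, Rmult_assoc.
        apply Rmult_le_compat_l.
        { apply pow_le. apply Rlt_le, Rdiv_lt_0_compat; lra. }
        apply (pow_fact_le_exp (INR p)). lra.
    + set (Q := fprod (widths r p l nu) 0 (n - i)).
      assert (HQ : Q * l ^ i <= fprod (widths r p l nu) 0 n).
      { replace n with (n - i + i)%nat at 1 by lia. rewrite fprod_add.
        apply Rmult_le_compat_l; [now apply Rlt_le, fprod_pos|].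
        apply fprod_ge_pow; [lra|exact Hwl]. }
      assert (HQ0 : 0 < Q) by now apply fprod_pos.
      apply Rle_trans with (exp (INR p) * eps ^ (r * p) * (c / eps) ^ n *
                (Q * l ^ i / l ^ (r * p))).
      * assert (Epl : l ^ (r * p) = l ^ (r * p - i) * l ^ i)
          by (rewrite <- pow_add; f_equal; lia).
        assert (Epe : eps ^ (r * p) = eps ^ (r * p - i) * eps ^ i)
          by (rewrite <- pow_add; f_equal; lia).
        assert (Epc : (c / eps) ^ n = (c / eps) ^ (n - i) * (c / eps) ^ i)
          by (rewrite <- pow_add; f_equal; lia).
        rewrite Epl, Epe, Epc.
        assert (Hl1 : l ^ i <> 0) by now apply Rgt_not_eq, pow_lt.
        assert (Hl2 : l ^ (r * p - i) <> 0) by now apply Rgt_not_eq, pow_lt.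
        replace (exp (INR p) * (eps ^ (r * p - i) * eps ^ i) *
          ((c / eps) ^ (n - i) * (c / eps) ^ i) *
          (Q * l ^ i / (l ^ (r * p - i) * l ^ i)))
          with ((eps * (c / eps)) ^ i * ((eps / l) ^ (r * p - i) * exp (INR p) *
            ((c / eps) ^ (n - i) * Q))).
        2:{ assert (Edl : (eps / l) ^ (r * p - i) = eps ^ (r * p - i) / l ^ (r * p - i))
              by (unfold Rdiv; now rewrite Rpow_mult_distr, pow_inv).
            rewrite Edl, (Rpow_mult_distr eps).
            generalize ((c / eps) ^ i) ((c / eps) ^ (n - i)). intros. field. now split. }
        (* The i derivatives taken by the monomial leave a surplus factor c^i >= 1. *)
        replace (eps * (c / eps)) with c by (field; lra).
        rewrite <- (Rmult_1_l ((eps / l) ^ _ * _ * _)) at 1.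
        apply Rmult_le_compat_r; [|now apply pow_R1_Rle].
        repeat apply Rmult_le_pos; try (apply Rlt_le, exp_pos); try lra; apply pow_le;
          apply Rlt_le, Rdiv_lt_0_compat; lra.
      * apply Rmult_le_compat_l.
        { repeat apply Rmult_le_pos; try (apply Rlt_le, exp_pos); apply pow_le; lra. }
        apply Rmult_le_compat_r; [apply Rlt_le, Rinv_0_lt_compat, pow_lt, Hl|exact HQ].
Qed.

(** * The function class *)

Lemma sup_over_finite {J : Type} (P : J -> Prop) (F : J -> R) :
  Rbar_lt (sup_over P F) p_infty <-> exists B, forall i, P i -> F i <= B.
Proof.
  unfold sup_over. set (E := fun y => exists i, P i /\ y = F i).
  destruct (Lub_Rbar_correct E) as [Hub Hlub]. split.
  - intros H. destruct (Lub_Rbar E) as [B| |].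
    + exists B. intros i Hi. apply (Hub (F i)). now exists i.
    + destruct H.
    (* A supremum [m_infty] means an empty family, so any bound will do. *)
    + exists 0. intros i Hi. destruct (Hub (F i)). now exists i.
  - intros [B HB]. apply Rbar_le_lt_trans with B; [|exact I].
    apply Hlub. intros y [i [Hi ->]]. now apply HB.
Qed.

Lemma Series_zero (a : nat -> R) : (forall k, a k = 0) -> Series a = 0.
Proof.
  intros H. rewrite (Series_ext a (fun k => 0 * a k)) by (intros k; rewrite H; ring).
  rewrite Series_scal_l. ring.
Qed.

Lemma finite_upper_bound (t : nat -> R) (p : nat) :
  exists B, forall j, (j < p)%nat -> t j <= B.
Proof.
  induction p as [|p [B HB]].
  - exists 0. intros j Hj. lia.
  - exists (Rmax B (t p)). intros j Hj.
    destruct (Nat.eq_dec j p) as [->|Hn]; [apply Rmax_r|].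
    apply Rle_trans with (2 := Rmax_l _ _). apply HB. lia.
Qed.

Lemma lambda_is_lub (M N : nat -> R) (p s : nat) :
  (0 < p)%nat ->
  (forall j, (j < p)%nat ->
     Rpower (M p / (INR s ^ p * N j)) (/ INR (p - j)) <= lambda M N p s) /\
  (forall B, (forall j, (j < p)%nat ->
     Rpower (M p / (INR s ^ p * N j)) (/ INR (p - j)) <= B) -> lambda M N p s <= B).
Proof.
  intros Hp.
  set (t := fun j => Rpower (M p / (INR s ^ p * N j)) (/ INR (p - j))).
  set (E := fun y => exists j, (j < p)%nat /\ y = t j).
  assert (El : lambda M N p s = real (Lub_Rbar E)) by reflexivity.
  rewrite El. clear El.
  destruct (Lub_Rbar_correct E) as [Hub Hlub].
  assert (Hle : forall B, (forall j, (j < p)%nat -> t j <= B) -> Rbar_le (Lub_Rbar E) B).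
  { intros B HB. apply Hlub. intros y [j [Hj ->]]. now apply HB. }
  destruct (finite_upper_bound t p) as [B0 HB0].
  specialize (Hle B0 HB0) as H0.
  assert (H1 : Rbar_le (t 0%nat) (Lub_Rbar E)) by (apply Hub; now exists 0%nat).
  destruct (Lub_Rbar E) as [l| |]; [|destruct H0|destruct H1].
  split.
  - intros j Hj. apply (Hub (t j)). now exists j.
  - intros B HB. exact (Hle B HB).
Qed.

(* The real functions of the class D_{r,{N}}([-1,1]), with the constants of the bound. *)
Record adm (r : nat) (N : nat -> R) (A h : R) (f : R -> R) : Prop := {
  adm_smooth : smooth f;
  adm_support : forall x, 1 < Rabs x -> f x = 0;
  adm_gap : forall n j, (1 <= j <= r - 1)%nat -> Derive_n f (r * n + j) 0 = 0;
  adm_bound : forall n x, Rabs (Derive_n f (r * n) x) <= A * (h ^ n * N n)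
}.

Lemma adm_weaken (r : nat) (N : nat -> R) (A A' h h' : R) (f : R -> R) :
  (forall n, 0 < N n) -> 0 <= A -> A <= A' -> 0 <= h -> h <= h' ->
  adm r N A h f -> adm r N A' h' f.
Proof.
  intros HN HA HAA Hh Hhh [H1 H2 H3 H4]. split; auto.
  intros n x. apply Rle_trans with (1 := H4 n x).
  assert (0 <= h ^ n) by now apply pow_le.
  apply Rmult_le_compat; auto.
  - apply Rmult_le_pos; auto. now apply Rlt_le.
  - apply Rmult_le_compat_r; [now apply Rlt_le|]. now apply pow_incr.
Qed.

Lemma adm_linear (r : nat) (N : nat -> R) (A B h a b : R) (f g : R -> R) :
  adm r N A h f -> adm r N B h g ->
  adm r N (Rabs a * A + Rabs b * B) h (fun x => a * f x + b * g x).
Proof.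
  intros [F1 F2 F3 F4] [G1 G2 G3 G4].
  destruct (smooth_linear f g a b F1 G1) as [Hs HD]. split.
  - exact Hs.
  - intros x Hx. rewrite F2, G2 by exact Hx. ring.
  - intros n j Hj. rewrite HD, F3, G3 by exact Hj. ring.
  - intros n x. rewrite HD. apply Rle_trans with (1 := Rabs_triang _ _).
    rewrite !Rabs_mult, Rmult_plus_distr_r, !Rmult_assoc.
    apply Rplus_le_compat; apply Rmult_le_compat_l; auto using Rabs_pos.
Qed.

(** Termwise differentiation needs a summable bound in every order. At order n it is drawn from the
    next multiple r (n / r + 1) by means of the support in [-1,1], at the cost of a power of 3 that
    is independent of k. *)
Lemma adm_Series (r : nat) (N : nat -> R) (A : nat -> R) (h : R) (F : nat -> R -> R) :
  (1 <= r)%nat -> (forall k, adm r N (A k) h (F k)) -> ex_series A ->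
  adm r N (Series A) h (fun x => Series (fun k => F k x)) /\
  forall n x, Derive_n (fun x => Series (fun k => F k x)) n x =
              Series (fun k => Derive_n (F k) n x).
Proof.
  intros Hr HF HA.
  set (c := fun n k => 3 ^ (r * S (n / r) - n) * (A k * (h ^ S (n / r) * N (S (n / r))))).
  destruct (smooth_Series F c) as [Hs HD].
  - intros k. apply HF.
  - intros n k x. apply Derive_n_le_higher; try apply HF.
    assert (E : (n + (r * S (n / r) - n) = r * S (n / r))%nat).
    { pose proof (Nat.div_mod n r ltac:(lia)). pose proof (Nat.mod_upper_bound n r ltac:(lia)).
      lia. }
    rewrite E. apply HF.
  - intros n. unfold c. apply (ex_series_scal_l (K := R_AbsRing) (V := R_NormedModule)).
    now apply ex_series_scal_r.
  - split; [|exact HD]. split.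
    + exact Hs.
    + intros x Hx. apply Series_zero. intros k. now apply (adm_support _ _ _ _ _ (HF k)).
    + intros n j Hj. rewrite HD. apply Series_zero. intros k.
      now apply (adm_gap _ _ _ _ _ (HF k)).
    + intros n x. rewrite HD, <- Series_scal_r.
      apply Series_abs_le; [|now apply ex_series_scal_r].
      intros k. apply (adm_bound _ _ _ _ _ (HF k)).
Qed.

Lemma Cmod_le_sum (z : C) : Cmod z <= Rabs (Re z) + Rabs (Im z).
Proof.
  pose proof (Cmod_2Rmax z). pose proof (Rmax_Cmod z).
  rewrite <- (Rabs_pos_eq (Rabs (Re z) + Rabs (Im z))) by
    (pose proof (Rabs_pos (Re z)); pose proof (Rabs_pos (Im z)); lra).
  rewrite <- (Rabs_pos_eq (Cmod z)) by apply Cmod_ge_0.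
  apply Rsqr_le_abs_0. unfold Cmod. rewrite Rsqr_sqrt by nra.
  unfold Rsqr. destruct z as [u v]; simpl. split_Rabs; nra.
Qed.

(** The real part alone is kept, since necessity prescribes only real sequences. *)
Lemma DR_adm (r : nat) (N : nat -> R) (f : R -> C) :
  (forall n, 0 < N n) -> DR r N f ->
  exists A h, 0 <= A /\ 0 < h /\ adm r N A h (fun x => Re (f x)).
Proof.
  intros HN [D1 D2 D3 [h [Hh D4]]].
  apply sup_over_finite in D4. destruct D4 as [B HB].
  assert (HB' : forall n x, Rabs (Derive_n (fun t => Re (f t)) (r * n) x) <= B * (h ^ n * N n)).
  { intros n x. assert (Hp : 0 < h ^ n * N n) by (apply Rmult_lt_0_compat; auto using pow_lt).
    specialize (HB (n, x) I). simpl in HB.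
    apply Rle_trans with (Cmod (CDerive_n f (r * n) x)).
    - apply (Rle_trans _ _ _ (Rmax_l _ (Rabs (snd (CDerive_n f (r * n) x))))).
      apply (Rmax_Cmod (CDerive_n f (r * n) x)).
    - apply Rmult_le_compat_r with (r := h ^ n * N n) in HB; [|now apply Rlt_le].
      unfold Rdiv in HB. rewrite Rmult_assoc, Rinv_l, Rmult_1_r in HB; lra. }
  exists B, h. repeat split; auto.
  - pose proof (Rle_trans _ _ _ (Rabs_pos (Derive_n (fun t => Re (f t)) (r * 0) 0))
      (HB' 0%nat 0)) as H. simpl in H.
    pose proof (HN 0%nat). rewrite Rmult_1_l in H.
    apply Rmult_le_reg_r with (N 0%nat); lra.
  - intros n x. apply (D1 n x).
  - intros x Hx. destruct (Req_dec (Re (f x)) 0) as [E|E]; [exact E|exfalso].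
    assert (Ha : support f x).
    { apply adherence_P1. intros H. apply E. now rewrite H. }
    apply D2 in Ha. split_Rabs; lra.
  - intros n j Hj. exact (f_equal fst (D3 n j Hj)).
Qed.

Lemma adm_DR (r : nat) (N : nat -> R) (A B h h' : R) (f g : R -> R) :
  (forall n, 0 < N n) -> 0 < h -> 0 < h' -> 0 <= A -> 0 <= B ->
  adm r N A h f -> adm r N B h' g -> DR r N (fun x => (f x, g x)).
Proof.
  intros HN Hh Hh' HA HB Hf Hg.
  apply (adm_weaken r N A A h (h + h')) in Hf; try lra; [|exact HN].
  apply (adm_weaken r N B B h' (h + h')) in Hg; try lra; [|exact HN].
  destruct Hf as [F1 F2 F3 F4], Hg as [G1 G2 G3 G4]. split.
  - intros n x. split; [apply F1|apply G1].
  - intros x Hx.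
    assert (Hn : ~ 1 < Rabs x).
    { intros Hlt.
      destruct (Hx (disc x (mkposreal _ (proj2 (Rlt_0_minus _ _) Hlt)))) as [y [Hy1 Hy2]].
      { now exists (mkposreal _ (proj2 (Rlt_0_minus _ _) Hlt)). }
      unfold disc in Hy1. simpl in Hy1. apply Hy2.
      assert (Hy : 1 < Rabs y) by (split_Rabs; lra).
      unfold RtoC. now rewrite F2, G2. }
    split_Rabs; lra.
  - intros n j Hj. unfold CDerive_n, RtoC. simpl.
    f_equal; [now apply F3|now apply G3].
  - exists (h + h'). split; [lra|]. apply sup_over_finite.
    exists (A + B). intros [n x] _. simpl.
    assert (Hp : 0 < (h + h') ^ n * N n)
      by (apply Rmult_lt_0_compat; [apply pow_lt; lra|apply HN]).
    apply Rmult_le_reg_r with (1 := Hp). unfold Rdiv.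
    rewrite Rmult_assoc, Rinv_l, Rmult_1_r by lra.
    apply Rle_trans with (1 := Cmod_le_sum _). simpl.
    rewrite Rmult_plus_distr_r. apply Rplus_le_compat; [apply F4|apply G4].
Qed.

(** * Sufficiency *)

Lemma Rpower_inv_pow (x : R) (m : nat) :
  0 < x -> (0 < m)%nat -> Rpower x (/ INR m) ^ m = x.
Proof.
  intros Hx Hm. rewrite <- Rpower_pow by apply exp_pos.
  rewrite Rpower_mult, Rinv_l, Rpower_1; auto. apply not_0_INR. lia.
Qed.

Lemma Rpower_inv_le (x y : R) (m : nat) :
  0 < x -> 0 < y -> (0 < m)%nat -> (Rpower x (/ INR m) <= y <-> x <= y ^ m).
Proof.
  intros Hx Hy Hm. assert (H0 : 0 < Rpower x (/ INR m)) by apply exp_pos.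
  split; intros H.
  - rewrite <- (Rpower_inv_pow x m) by assumption. apply pow_incr. lra.
  - apply Rle_trans with (Rpower (y ^ m) (/ INR m)).
    + apply Rle_Rpower_l; [|lra]. now apply Rlt_le, Rinv_0_lt_compat, lt_0_INR.
    + rewrite <- Rpower_pow, Rpower_mult, Rinv_r, Rpower_1 by (auto; apply not_0_INR; lia).
      apply Rle_refl.
Qed.

Lemma quot_pos (N : nat -> R) (k : nat) : (forall n, 0 < N n) -> 0 < quot N k.
Proof. intros H. destruct k; simpl; [lra|]. now apply Rdiv_lt_0_compat. Qed.

Lemma quot_mono (N : nat -> R) (j k : nat) :
  LC N -> (1 <= j)%nat -> (j <= k)%nat -> quot N j <= quot N k.
Proof.
  intros [Hpos H0 H1 Hc Hroot] Hj. induction 1 as [|k Hk IH]; [lra|].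
  apply Rle_trans with (1 := IH). destruct k as [|k]; [lia|]. simpl.
  specialize (Hc (S k) ltac:(lia)).
  replace (S k - 1)%nat with k in Hc by lia. replace (S k + 1)%nat with (S (S k)) in Hc by lia.
  pose proof (Hpos k). pose proof (Hpos (S k)).
  apply Rmult_le_reg_r with (N k * N (S k)); [nra|].
  replace (N (S k) / N k * (N k * N (S k))) with (N (S k) ^ 2) by (field; lra).
  replace (N (S (S k)) / N (S k) * (N k * N (S k))) with (N k * N (S (S k))) by (field; lra).
  exact Hc.
Qed.

(** N p / N j is a product of p - j quotients, none of which exceeds [quot N p] by log-convexity. *)
Lemma LC_le_quot_pow (N : nat -> R) (p j : nat) :
  LC N -> (j <= p)%nat -> N p <= N j * quot N p ^ (p - j).
Proof.
  intros HN Hj.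
  assert (H : forall m, (m <= p)%nat -> N p <= N (p - m)%nat * quot N p ^ m).
  { induction m as [|m IH]; intros Hm.
    - rewrite Nat.sub_0_r. simpl. lra.
    - apply Rle_trans with (1 := IH ltac:(lia)).
      replace (p - m)%nat with (S (p - S m)) by lia.
      assert (Hq := quot_mono N (S (p - S m)) p HN ltac:(lia) ltac:(lia)). simpl in Hq |- *.
      pose proof (LC_pos _ HN (p - S m)). pose proof (LC_pos _ HN (S (p - S m))).
      apply Rmult_le_compat_r with (r := N (p - S m)%nat) in Hq; [|lra].
      replace (N (S (p - S m)) / N (p - S m)%nat * N (p - S m)%nat)
        with (N (S (p - S m))) in Hq by (field; lra).
      rewrite <- Rmult_assoc. apply Rmult_le_compat_r; [|lra].
      apply pow_le, Rlt_le, quot_pos, (LC_pos _ HN). }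
  specialize (H (p - j)%nat ltac:(lia)).
  now replace (p - (p - j))%nat with j in H by lia.
Qed.

Lemma lambda_pos (M N : nat -> R) (p s : nat) :
  (0 < p)%nat -> 0 < lambda M N p s.
Proof.
  intros Hp. apply Rlt_le_trans with (2 := proj1 (lambda_is_lub M N p s Hp) 0%nat Hp).
  apply exp_pos.
Qed.

Lemma lambda_le_iff (M N : nat -> R) (p s : nat) (y : R) :
  (forall n, 0 < M n) -> (forall n, 0 < N n) -> (0 < p)%nat -> (0 < s)%nat -> 0 < y ->
  (lambda M N p s <= y <->
   forall j, (j < p)%nat -> M p <= INR s ^ p * N j * y ^ (p - j)).
Proof.
  intros HM HN Hp Hs Hy. destruct (lambda_is_lub M N p s Hp) as [Hub Hlub].
  assert (E : forall j, (j < p)%nat ->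
    (Rpower (M p / (INR s ^ p * N j)) (/ INR (p - j)) <= y <->
     M p <= INR s ^ p * N j * y ^ (p - j))).
  { intros j Hj.
    assert (Hd : 0 < INR s ^ p * N j).
    { apply Rmult_lt_0_compat; [apply pow_lt, lt_0_INR, Hs|apply HN]. }
    rewrite Rpower_inv_le; [|now apply Rdiv_lt_0_compat|exact Hy|lia].
    split; intros H.
    - apply Rmult_le_compat_l with (r := INR s ^ p * N j) in H; [|lra].
      replace (INR s ^ p * N j * (M p / (INR s ^ p * N j))) with (M p) in H; [exact H|].
      field. split; [apply Rgt_not_eq, HN|apply Rgt_not_eq, pow_lt, lt_0_INR, Hs].
    - apply Rmult_le_reg_l with (INR s ^ p * N j); [exact Hd|].
      replace (INR s ^ p * N j * (M p / (INR s ^ p * N j))) with (M p); [exact H|].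
      field. split; [apply Rgt_not_eq, HN|apply Rgt_not_eq, pow_lt, lt_0_INR, Hs]. }
  split.
  - intros H j Hj. apply E; [exact Hj|]. apply Rle_trans with (2 := H). now apply Hub.
  - intros H. apply Hlub. intros j Hj. apply E; auto.
Qed.

(** For such s, [lambda] stays below the quotients from p on, so that the first r p entries of
    [widths] are the smallest ones. *)
Lemma lambda_le_quot (M N : nat -> R) (p s : nat) :
  LC N -> (forall n, 0 < M n) -> (0 < p)%nat -> (0 < s)%nat ->
  M p <= INR s ^ p * N p -> lambda M N p s <= quot N p.
Proof.
  intros HN HM Hp Hs H.
  apply lambda_le_iff; auto; try apply (LC_pos _ HN); try apply quot_pos, (LC_pos _ HN).
  intros j Hj. apply Rle_trans with (1 := H). rewrite Rmult_assoc.
  apply Rmult_le_compat_l; [apply pow_le, pos_INR|].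
  apply LC_le_quot_pow; [exact HN|lia].
Qed.

(** The nu_k of the overview: r equal factors make up one quotient of [N]. *)
Definition rquot (r : nat) (N : nat -> R) (k : nat) : R := Rpower (quot N k) (/ INR r).

Lemma rquot_pos (r : nat) (N : nat -> R) (k : nat) : 0 < rquot r N k.
Proof. apply exp_pos. Qed.

Lemma rquot_mono (r : nat) (N : nat -> R) (j k : nat) :
  LC N -> (1 <= r)%nat -> (1 <= j)%nat -> (j <= k)%nat -> rquot r N j <= rquot r N k.
Proof.
  intros HN Hr Hj Hk. apply Rle_Rpower_l.
  - apply Rlt_le, Rinv_0_lt_compat, lt_0_INR. lia.
  - split; [apply quot_pos, (LC_pos _ HN)|now apply quot_mono].
Qed.

Lemma rquot_pow (r : nat) (N : nat -> R) (k : nat) :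
  (forall n, 0 < N n) -> (1 <= r)%nat -> rquot r N k ^ r = quot N k.
Proof. intros HN Hr. apply Rpower_inv_pow; [now apply quot_pos|lia]. Qed.

Lemma rquot_inv (r : nat) (N : nat -> R) (k : nat) :
  (forall n, 0 < N n) -> Rpower (/ quot N k) (/ INR r) = / rquot r N k.
Proof.
  intros HN. unfold rquot. assert (Hq := quot_pos N k HN).
  rewrite <- Rpower_Ropp. unfold Rpower. rewrite ln_Rinv by exact Hq. f_equal. ring.
Qed.

Lemma rquot_prod (r : nat) (N : nat -> R) (p K : nat) :
  (forall n, 0 < N n) -> (1 <= r)%nat ->
  fprod (fun k => rquot r N (S k)) p K ^ r * N p = N (p + K)%nat.
Proof.
  intros HN Hr. revert p. induction K as [|K IH]; intros p.
  - simpl. rewrite pow1, Nat.add_0_r. ring.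
  - simpl fprod. rewrite Rpow_mult_distr, rquot_pow by assumption.
    replace (p + S K)%nat with (S p + K)%nat by lia. rewrite <- IH. simpl quot.
    field. apply Rgt_not_eq, HN.
Qed.

(** For n < p the product is l^(r n), and the claim is the hypothesis at j = n times l^(r n). For n
    >= p it is l^(r p) N n / N p, and what remains is M p <= s^p N p. *)
Lemma widths_prod_le (r p s n : nat) (l : R) (M N : nat -> R) :
  (1 <= r)%nat -> (forall n, 0 < M n) -> (forall n, 0 < N n) -> 0 < l ->
  (forall j, (j < p)%nat -> M p <= INR s ^ p * N j * l ^ (r * (p - j))) ->
  M p <= INR s ^ p * N p ->
  fprod (widths r p l (rquot r N)) 0 (r * n) * M p <= INR s ^ p * N n * l ^ (r * p).
Proof.
  intros Hr HM HN Hl Hj Hp. destruct (Nat.lt_ge_cases n p) as [H|H].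
  - rewrite (fprod_const _ l) by (intros i Hi; apply widths_low; nia).
    replace (r * p)%nat with (r * n + r * (p - n))%nat by nia.
    rewrite pow_add.
    replace (INR s ^ p * N n * (l ^ (r * n) * l ^ (r * (p - n))))
      with (l ^ (r * n) * (INR s ^ p * N n * l ^ (r * (p - n)))) by ring.
    apply Rmult_le_compat_l; [apply pow_le; lra|now apply Hj].
  - replace (r * n)%nat with (r * p + r * (n - p))%nat by nia.
    rewrite fprod_add, Nat.add_0_l.
    rewrite (fprod_const _ l) by (intros i Hi; now apply widths_low).
    rewrite (fprod_blocks r _ (fun k => rquot r N (S k))).
    2:{ intros k i Hk Hi. now apply widths_high. }
    pose proof (rquot_prod r N p (n - p) HN Hr) as E.
    replace (p + (n - p))%nat with n in E by lia. rewrite <- E.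
    set (F := fprod (fun k => rquot r N (S k)) p (n - p) ^ r).
    replace (INR s ^ p * (F * N p) * l ^ (r * p))
      with (l ^ (r * p) * F * (INR s ^ p * N p)) by ring.
    apply Rmult_le_compat_l; [|exact Hp].
    apply Rmult_le_pos; [apply pow_le; lra|].
    apply pow_le, Rlt_le, fprod_pos. intros; apply rquot_pos.
Qed.

Lemma exp_INR (n : nat) : exp (INR n) = exp 1 ^ n.
Proof.
  induction n as [|n IH]; [apply exp_0|].
  rewrite S_INR, exp_plus, IH. simpl. ring.
Qed.

Lemma adm_scal (r : nat) (N : nat -> R) (A h a : R) (f : R -> R) :
  adm r N A h f -> adm r N (Rabs a * A) h (fun x => a * f x).
Proof.
  intros [F1 F2 F3 F4]. split.
  - intros n x. now apply ex_derive_n_scal_l.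
  - intros x Hx. rewrite F2 by exact Hx. ring.
  - intros n j Hj. rewrite Derive_n_scal_l, F3 by exact Hj. ring.
  - intros n x. rewrite Derive_n_scal_l, Rabs_mult, Rmult_assoc.
    apply Rmult_le_compat_l; [apply Rabs_pos|apply F4].
Qed.

Lemma adm_nonneg (r : nat) (N : nat -> R) (A h : R) (f : R -> R) :
  0 < N 0%nat -> adm r N A h f -> 0 <= A.
Proof.
  intros HN Hf. pose proof (adm_bound _ _ _ _ _ Hf 0%nat 0) as H.
  apply Rmult_le_reg_r with (N 0%nat); [exact HN|].
  rewrite Rmult_0_l. simpl in H. rewrite Rmult_1_l in H.
  apply Rle_trans with (2 := H), Rabs_pos.
Qed.

Lemma Series_single (u : nat -> R) (j : nat) :
  (forall k, k <> j -> u k = 0) -> Series u = u j.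
Proof.
  intros H. apply is_series_unique.
  assert (E : forall n, sum_n u n = if (n <? j)%nat then 0 else u j).
  { induction n as [|n IH].
    - rewrite sum_O. destruct (Nat.ltb_spec 0 j) as [Hj|Hj]; [apply H; lia|].
      f_equal. lia.
    - rewrite sum_Sn, IH. unfold plus; simpl.
      destruct (Nat.ltb_spec n j), (Nat.ltb_spec (S n) j); try lia.
      + rewrite H by lia. ring.
      + replace (S n) with j by lia. ring.
      + rewrite (H (S n)) by lia. ring. }
  change (is_lim_seq (sum_n u) (u j)).
  apply (is_lim_seq_ext_loc (fun _ => u j)); [|apply is_lim_seq_const].
  exists j. intros n Hn. rewrite E. now rewrite (proj2 (Nat.ltb_ge _ _)).
Qed.

(** * Interpolation of a real sequence *)

(** For p >= 1 the constant is (e s eps)^p / M p: e^p comes from the monomial, s^p / M p from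
    [widths_prod_le], and eps^(r p) <= eps^p as eps <= 1. The growth constant does not depend on
    p. *)
Lemma kernel_family (r s : nat) (M N : nat -> R) (l : nat -> R) (B B' eps : R) :
  (1 <= r)%nat -> (forall n, 0 < M n) -> (forall n, 0 < N n) -> 0 <= B ->
  (forall p, (1 <= p)%nat -> 0 < l p) ->
  (forall p j, (j < p)%nat -> M p <= INR s ^ p * N j * l p ^ (r * (p - j))) ->
  (forall p, M p <= INR s ^ p * N p) ->
  (forall p k, (1 <= p)%nat -> (p < k)%nat -> l p <= rquot r N k) ->
  (forall p K, (1 <= p)%nat ->
     fsum (fun k => / rquot r N (S k)) p K <= B * (INR p / l p)) ->
  (forall p, (1 <= p)%nat -> INR p / l p <= B') ->
  0 < eps -> eps <= 1 -> eps * B' <= 1 ->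
  forall p, exists f c,
    adm r N c ((2 * (4 * INR r * (1 + B) / eps)) ^ r) f /\
    (forall n, Derive_n f n 0 = if (n =? r * p)%nat then 1 else 0) /\
    ((1 <= p)%nat -> c * M p <= (exp 1 * INR s * eps) ^ p).
Proof.
  intros Hr HM HN HB Hl HMN1 HMN2 Hlnu Hsum HB' He0 He1 HeB' p.
  assert (Hr1 : 1 <= INR r) by (apply (le_INR 1); exact Hr).
  set (c0 := 4 * INR r * (1 + B) / eps).
  assert (Hc0 : 0 < c0) by (unfold c0; apply Rdiv_lt_0_compat; nra).
  assert (Hgap : forall f, (forall n, Derive_n f n 0 = if (n =? r * p)%nat then 1 else 0) ->
     forall n j, (1 <= j <= r - 1)%nat -> Derive_n f (r * n + j) 0 = 0).
  { intros f Hf n j Hj. rewrite Hf. destruct (Nat.eqb_spec (r * n + j) (r * p)); [|reflexivity].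
    exfalso. assert (r * (p - n) = j)%nat by nia. destruct (p - n)%nat; nia. }
  assert (Hsupp : forall q, (1 <= q)%nat -> eps * (INR q / l q) <= 1).
  { intros q Hq. apply Rle_trans with (2 := HeB').
    apply Rmult_le_compat_l; [lra|now apply HB']. }
  destruct (Nat.eq_dec p 0) as [->|Hp].
  (* Level 0 has no l_p; the cutoff of level 1 already has the required jet, and the size of its
     constant is immaterial. *)
  - destruct (cutoff_kernel r 1 (l 1%nat) B eps (rquot r N))
      as [f [d [Hd [Hs [H1 [H0 HD]]]]]]; auto.
    assert (HJ : forall n, Derive_n f n 0 = if (n =? r * 0)%nat then 1 else 0).
    { intros n. rewrite Nat.mul_0_r, (Derive_n_eq_near_0 f (monom 0) d n Hd).
      - apply monom_Derive_n_0.
      - intros x Hx. rewrite H1 by exact Hx. unfold monom. simpl. field. }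
    exists f, (INR s * l 1%nat ^ r / M 1%nat). split; [|split]; [|exact HJ|lia].
    split; auto.
    + intros x Hx. apply H0. apply Rle_lt_trans with (2 := Hx). now apply (Hsupp 1%nat).
    + intros n x. apply Rle_trans with (1 := HD _ _). fold c0.
      pose proof (widths_prod_le r 1 s n (l 1%nat) M N Hr HM HN (Hl _ (le_n _))
        (HMN1 1%nat) (HMN2 1%nat)) as HW.
      rewrite Nat.mul_1_r, pow_1 in HW.
      rewrite <- pow_mult, Rpow_mult_distr.
      assert (H2 : 1 <= 2 ^ (r * n)) by (apply pow_R1_Rle; lra).
      assert (H3 : 0 <= c0 ^ (r * n)) by (apply pow_le; lra).
      apply Rle_trans with (c0 ^ (r * n) * (INR s * N n * l 1%nat ^ r / M 1%nat)).
      * apply Rmult_le_compat_l; [exact H3|].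
        apply Rmult_le_reg_r with (M 1%nat); [apply HM|].
        unfold Rdiv. rewrite (Rmult_assoc (_ * _)), Rinv_l, Rmult_1_r; [exact HW|].
        apply Rgt_not_eq, HM.
      * replace (INR s * l 1%nat ^ r / M 1%nat * (2 ^ (r * n) * c0 ^ (r * n) * N n))
          with (2 ^ (r * n) * (c0 ^ (r * n) * (INR s * N n * l 1%nat ^ r / M 1%nat)))
          by (unfold Rdiv; ring).
        rewrite <- (Rmult_1_l (c0 ^ (r * n) * _)) at 1.
        apply Rmult_le_compat_r; [|exact H2].
        apply Rmult_le_pos; [exact H3|]. apply Rmult_le_pos.
        -- repeat apply Rmult_le_pos; [apply pos_INR|apply Rlt_le, HN|].
           apply pow_le, Rlt_le, Hl, le_n.
        -- apply Rlt_le, Rinv_0_lt_compat, HM.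
  - assert (Hp1 : (1 <= p)%nat) by lia.
    destruct (kernel_exists r p (l p) B eps (rquot r N)) as [f [Hs [H0 [HJ HD]]]]; auto.
    exists f, ((exp 1 * INR s * eps) ^ p / M p). split; [|split].
    2:{ exact HJ. }
    2:{ intros _. apply Req_le. field. apply Rgt_not_eq, HM. }
    split; auto.
    intros n x. apply Rle_trans with (1 := HD _ _). fold c0.
    pose proof (widths_prod_le r p s n (l p) M N Hr HM HN (Hl _ Hp1)
        (HMN1 p) (HMN2 p)) as HW.
    assert (Hlp : 0 < l p ^ (r * p)) by now apply pow_lt, Hl.
    assert (HW' : fprod (widths r p (l p) (rquot r N)) 0 (r * n) / l p ^ (r * p)
                  <= INR s ^ p * N n / M p).
    { pose proof (HM p).
      apply Rmult_le_reg_r with (M p * l p ^ (r * p)); [nra|].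
      replace (fprod (widths r p (l p) (rquot r N)) 0 (r * n) / l p ^ (r * p) *
                 (M p * l p ^ (r * p)))
        with (fprod (widths r p (l p) (rquot r N)) 0 (r * n) * M p) by (field; lra).
      replace (INR s ^ p * N n / M p * (M p * l p ^ (r * p)))
        with (INR s ^ p * N n * l p ^ (r * p)) by (field; lra).
      exact HW. }
    assert (Hep : eps ^ (r * p) <= eps ^ p).
    { replace (r * p)%nat with (p + (r - 1) * p)%nat by nia. rewrite pow_add.
      rewrite <- (Rmult_1_r (eps ^ p)) at 2.
      apply Rmult_le_compat_l; [apply pow_le; lra|].
      rewrite <- (pow1 ((r - 1) * p)). apply pow_incr. lra. }
    rewrite exp_INR, <- (pow_mult _ r n), !Rpow_mult_distr.
    apply Rle_trans with (2 ^ (r * n) * (exp 1 ^ p * eps ^ p * c0 ^ (r * n) *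
                            (INR s ^ p * N n / M p))).
    + apply Rmult_le_compat_l; [apply pow_le; lra|].
      assert (0 <= exp 1 ^ p) by (apply pow_le, Rlt_le, exp_pos).
      assert (0 <= eps ^ (r * p)) by (apply pow_le; lra).
      assert (0 <= c0 ^ (r * n)) by (apply pow_le; lra).
      apply Rmult_le_compat.
      * repeat apply Rmult_le_pos; assumption.
      * apply Rmult_le_pos; [|now apply Rlt_le, Rinv_0_lt_compat].
        apply Rlt_le, fprod_pos. intros i.
        apply Rlt_le_trans with (1 := Hl p Hp1). apply widths_ge; auto.
      * apply Rmult_le_compat_r; [assumption|]. now apply Rmult_le_compat_l.
      * exact HW'.
    + apply Req_le. unfold Rdiv. ring.
Qed.

Lemma real_interpolation (r s : nat) (M N : nat -> R) (l : nat -> R) (B B' : R) :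
  (1 <= r)%nat -> (forall n, 0 < M n) -> (forall n, 0 < N n) -> 0 <= B -> 0 <= B' ->
  (forall p, (1 <= p)%nat -> 0 < l p) ->
  (forall p j, (j < p)%nat -> M p <= INR s ^ p * N j * l p ^ (r * (p - j))) ->
  (forall p, M p <= INR s ^ p * N p) ->
  (forall p k, (1 <= p)%nat -> (p < k)%nat -> l p <= rquot r N k) ->
  (forall p K, (1 <= p)%nat ->
     fsum (fun k => / rquot r N (S k)) p K <= B * (INR p / l p)) ->
  (forall p, (1 <= p)%nat -> INR p / l p <= B') ->
  forall (a : nat -> R) (A H : R), 0 <= A -> 0 <= H ->
  (forall p, Rabs (a p) <= A * (H ^ p * M p)) ->
  exists f A' h', 0 <= A' /\ 0 < h' /\ adm r N A' h' f /\
    forall j, a j = Derive_n f (r * j) 0.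
Proof.
  intros Hr HM HN HB HB0 Hl HMN1 HMN2 Hlnu Hsum HB' a A H HA HH Ha.
  assert (Hr1 : 1 <= INR r) by (apply (le_INR 1); exact Hr).
  set (T := H * (exp 1 * INR s)).
  assert (HT : 0 <= T).
  { repeat apply Rmult_le_pos; [exact HH|apply Rlt_le, exp_pos|apply pos_INR]. }
  (* Gives at once eps <= 1, eps B' <= 1 for the supports, and T eps <= 1/2 for a geometric majorant
     of the series. *)
  set (eps := / (1 + B' + 2 * T)).
  assert (He0 : 0 < eps) by (apply Rinv_0_lt_compat; lra).
  assert (HeE : eps * (1 + B' + 2 * T) = 1) by (apply Rinv_l; lra).
  assert (He1 : eps <= 1) by nra.
  assert (HeB : eps * B' <= 1) by nra.
  assert (HeT : 0 <= T * eps <= / 2) by nra.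
  set (h := (2 * (4 * INR r * (1 + B) / eps)) ^ r).
  assert (Hh : 0 < h).
  { apply pow_lt. apply Rmult_lt_0_compat; [lra|]. apply Rdiv_lt_0_compat; nra. }
  pose proof (kernel_family r s M N l B B' eps Hr HM HN HB Hl HMN1 HMN2 Hlnu Hsum HB'
                He0 He1 HeB) as HK.
  fold h in HK.
  destruct (functional_choice (fun p (fc : (R -> R) * R) =>
    adm r N (snd fc) h (fst fc) /\
    (forall n, Derive_n (fst fc) n 0 = if (n =? r * p)%nat then 1 else 0) /\
    ((1 <= p)%nat -> snd fc * M p <= (exp 1 * INR s * eps) ^ p))) as [chi Hchi].
  { intros p. destruct (HK p) as [f [c Hfc]]. now exists (f, c). }
  set (F := fun p x => a p * fst (chi p) x).
  assert (HF : forall p, adm r N (Rabs (a p) * snd (chi p)) h (F p)).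
  { intros p. apply adm_scal, (Hchi p). }
  assert (Hc : forall p, 0 <= snd (chi p)).
  { intros p. apply (adm_nonneg r N _ h (fst (chi p))); [apply HN|apply (Hchi p)]. }
  assert (Hex : ex_series (fun p => Rabs (a p) * snd (chi p))).
  (* [kernel_family] does not estimate the constant at p = 0, so this term is put into the factor of
     the geometric majorant. *)
  { apply ex_series_abs_le with
      (fun p => (A + Rabs (a 0%nat) * snd (chi 0%nat)) * (/ 2) ^ p).
    - intros p. rewrite Rabs_pos_eq by (apply Rmult_le_pos; [apply Rabs_pos|apply Hc]).
      destruct (Nat.eq_dec p 0) as [->|Hp].
      { simpl. lra. }
      assert (0 <= Rabs (a 0%nat) * snd (chi 0%nat))
        by (apply Rmult_le_pos; [apply Rabs_pos|apply Hc]).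
      apply Rle_trans with (A * (/ 2) ^ p).
      + destruct (Hchi p) as [_ [_ H3]]. specialize (H3 ltac:(lia)).
        apply Rle_trans with (A * (H ^ p * M p) * snd (chi p)).
        { apply Rmult_le_compat_r; auto. }
        rewrite Rmult_assoc. apply Rmult_le_compat_l; [exact HA|].
        rewrite Rmult_assoc, (Rmult_comm (M p)).
        apply Rle_trans with (H ^ p * (exp 1 * INR s * eps) ^ p).
        { apply Rmult_le_compat_l; [now apply pow_le|exact H3]. }
        rewrite <- Rpow_mult_distr. apply pow_incr.
        unfold T in HeT. lra.
      + apply Rmult_le_compat_r; [apply pow_le; lra|lra].
    - apply (ex_series_scal_l (K := R_AbsRing) (V := R_NormedModule)).
      apply ex_series_geom. rewrite Rabs_pos_eq; lra. }
  destruct (adm_Series r N _ h F Hr HF Hex) as [Hadm HD].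
  exists (fun x => Series (fun p => F p x)), (Series (fun p => Rabs (a p) * snd (chi p))), h.
  split; [|split; [|split]]; auto.
  - apply (adm_nonneg r N _ h _ (HN 0%nat) Hadm).
  - intros j. rewrite HD, (Series_single _ j).
    + unfold F. rewrite Derive_n_scal_l. destruct (Hchi j) as [_ [HJ _]].
      rewrite HJ, Nat.eqb_refl. ring.
    + intros k Hk. unfold F. rewrite Derive_n_scal_l. destruct (Hchi k) as [_ [HJ _]].
      rewrite HJ. destruct (Nat.eqb_spec (r * j) (r * k)); [nia|ring].
Qed.

(** * Consequences of the liminf hypothesis and of (SV) *)

Lemma pow_le_inv (x y : R) (m : nat) :
  0 < x -> 0 < y -> (0 < m)%nat -> x ^ m <= y ^ m -> x <= y.
Proof.
  intros Hx Hy Hm H. apply Rpower_inv_le in H; [|now apply pow_lt|exact Hy|exact Hm].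
  rewrite <- Rpower_pow, Rpower_mult, Rinv_r, Rpower_1 in H by (auto; apply not_0_INR; lia).
  exact H.
Qed.

Lemma LC_ge_1 (M : nat -> R) (p : nat) : LC M -> 1 <= M p.
Proof.
  intros HM. induction p as [|p IH]; [rewrite (LC_zero _ HM); lra|].
  apply Rle_trans with (1 := IH).
  pose proof (LC_pos _ HM p) as Hp.
  assert (Hq : 1 <= quot M (S p)).
  { apply Rle_trans with (quot M 1).
    - simpl. rewrite (LC_zero _ HM), Rdiv_1_r. apply (LC_one _ HM).
    - apply quot_mono; [exact HM|lia|lia]. }
  simpl in Hq. apply Rmult_le_compat_r with (r := M p) in Hq; [|lra].
  unfold Rdiv in Hq. rewrite Rmult_assoc, Rinv_l in Hq; lra.
Qed.

(** The liminf gives c from some P on. Below P, the bounds u p >= 1 and c <= 1 / P! suffice, since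
    c^p p! <= c P! <= 1 for p >= 1. *)
Lemma liminf_root_factorial (u : nat -> R) :
  (forall p, 1 <= u p) ->
  Rbar_lt 0 (LimInf_seq (fun p => Rpower (u p / INR (fact p)) (/ INR p))) ->
  exists c, 0 < c /\ forall p, (1 <= p)%nat -> c ^ p * INR (fact p) <= u p.
Proof.
  intros Hu Hlim.
  assert (H : exists c P, 0 < c /\ forall p, (P <= p)%nat ->
            c < Rpower (u p / INR (fact p)) (/ INR p)).
  { unfold LimInf_seq in Hlim. destruct (ex_LimInf_seq _) as [l Hl]; simpl in Hlim.
    destruct l as [l| |].
    - assert (He : 0 < l / 2) by lra.
      destruct (Hl (mkposreal _ He)) as [_ [P HP]]. exists (l / 2), P.
      split; [exact He|]. intros p Hp. specialize (HP p Hp). simpl in HP. lra.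
    - destruct (Hl 1) as [P HP]. exists 1, P. split; [lra|exact HP].
    - destruct Hlim. }
  destruct H as [c0 [P [Hc0 HP]]].
  assert (HfP : 1 <= INR (fact P)) by (apply (le_INR 1), lt_O_fact).
  set (c := Rmin c0 (/ INR (fact P))).
  assert (Hc : 0 < c) by (apply Rmin_pos; [exact Hc0|apply Rinv_0_lt_compat; lra]).
  assert (Hc1 : c * INR (fact P) <= 1).
  { apply Rle_trans with (/ INR (fact P) * INR (fact P)).
    - apply Rmult_le_compat_r; [lra|apply Rmin_r].
    - rewrite Rinv_l; lra. }
  exists c. split; [exact Hc|]. intros p Hp.
  pose proof (INR_fact_lt_0 p) as Hf.
  destruct (Nat.le_gt_cases P p) as [H|H].
  - assert (Hd : 0 < u p / INR (fact p))
      by (apply Rdiv_lt_0_compat; [specialize (Hu p); lra|exact Hf]).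
    apply Rmult_le_reg_r with (/ INR (fact p)); [now apply Rinv_0_lt_compat|].
    rewrite Rmult_assoc, Rinv_r, Rmult_1_r by lra.
    rewrite <- (Rpower_inv_pow (u p * / INR (fact p)) p) by (auto; lia).
    apply pow_incr. split; [lra|].
    apply Rle_trans with (1 := Rmin_l _ _), Rlt_le, (HP p H).
  - apply Rle_trans with (2 := Hu p). apply Rle_trans with (2 := Hc1).
    apply Rmult_le_compat; try (apply pow_le; lra); try lra.
    + destruct p as [|p]; [lia|]. rewrite <- tech_pow_Rmult.
      assert (Hcp : c ^ p <= 1); [|nra].
      rewrite <- (pow1 p). apply pow_incr.
      split; [lra|]. apply Rle_trans with (1 := Rmin_r _ _).
      rewrite <- Rinv_1. apply Rinv_le_contravar; lra.
    + apply le_INR, fact_le. lia.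
Qed.

Lemma fsum_sum_n (g : nat -> R) (n K : nat) :
  fsum g n (S K) = sum_n (fun k => g (n + k)%nat) K.
Proof.
  induction K as [|K IH].
  - rewrite sum_O. simpl. rewrite Nat.add_0_r. ring.
  - rewrite sum_Sn, <- IH. replace (S (S K)) with (S K + 1)%nat by lia.
    rewrite fsum_add. unfold plus; simpl. replace (n + S K)%nat with (S (n + K))%nat by lia.
    ring.
Qed.

Lemma fsum_shift (g : nat -> R) (n K : nat) :
  fsum (fun k => g (S k)) n K = fsum g (S n) K.
Proof. revert n. induction K as [|K IH]; intros n; simpl; [reflexivity|]. now rewrite IH. Qed.

Definition rlambda (r : nat) (M N : nat -> R) (p s : nat) : R :=
  Rpower (lambda M N p s) (/ INR r).

(** Clears all roots. Taken at y = [rlambda] itself, it yields the inequalities on M p that the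
    kernels require; read from right to left, it is how necessity bounds [rlambda]. *)
Lemma rlambda_le_iff (r : nat) (M N : nat -> R) (p s : nat) (y : R) :
  (1 <= r)%nat -> (forall n, 0 < M n) -> (forall n, 0 < N n) ->
  (0 < p)%nat -> (0 < s)%nat -> 0 < y ->
  (rlambda r M N p s <= y <->
   forall j, (j < p)%nat -> M p <= INR s ^ p * N j * y ^ (r * (p - j))).
Proof.
  intros Hr HM HN Hp Hs Hy. unfold rlambda.
  rewrite Rpower_inv_le; [|now apply lambda_pos|exact Hy|lia].
  rewrite lambda_le_iff by (auto; now apply pow_lt).
  split; intros H j Hj; specialize (H j Hj); [rewrite pow_mult|rewrite pow_mult in H]; exact H.
Qed.

Lemma SV_sufficient (r : nat) (M N : nat -> R) (K : R) :
  (1 <= r)%nat -> LC M -> LC N ->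
  Rbar_lt 0
     (LimInf_seq (fun p =>
        Rpower (Rpower (M p) (/ INR r) / INR (fact p)) (/ INR p))) ->
  1 <= K -> (forall p, M p <= K ^ p * N p) ->
  SV r M N -> forall a : nat -> C, LambdaR M a -> borel_image r N a.
Proof.
  intros Hr HM HN Hlim HK HMN [s0 [Hs0 [Hex Hsup]]] a [H [HH Ha]].
  pose proof (LC_pos _ HM) as HMp. pose proof (LC_pos _ HN) as HNp.
  apply sup_over_finite in Hsup, Ha. destruct Hsup as [B0 HB0], Ha as [A0 HA0].
  destruct (INR_unbounded K) as [n0 Hn0].
  (* s0 comes from (SV) and n0 exceeds K: the larger s lowers lambda, which keeps the bound of (SV),
     and ensures M p <= s^p N p. *)
  set (s := (s0 + n0)%nat).
  assert (Hs : (0 < s)%nat) by (unfold s; lia).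
  assert (HsK : K <= INR s)
    by (unfold s; rewrite plus_INR; pose proof (pos_INR s0); lra).
  assert (Hs1 : 1 <= INR s) by lra.
  set (l := fun p => rlambda r M N p s).
  assert (Hl : forall p, 0 < l p) by (intros p; apply exp_pos).
  assert (HMN1 : forall p j, (j < p)%nat -> M p <= INR s ^ p * N j * l p ^ (r * (p - j))).
  { intros p j Hj. apply (rlambda_le_iff r M N p s (l p)); auto; [lia|apply Rle_refl]. }
  assert (HMN2 : forall p, M p <= INR s ^ p * N p).
  { intros p. apply Rle_trans with (1 := HMN p).
    apply Rmult_le_compat_r; [apply Rlt_le, HNp|]. apply pow_incr. lra. }
  assert (Hl0 : forall p, (1 <= p)%nat -> l p <= rlambda r M N p s0).
  { intros p Hp. apply rlambda_le_iff; auto; try apply exp_pos.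
    intros j Hj.
    apply Rle_trans with (INR s0 ^ p * N j * rlambda r M N p s0 ^ (r * (p - j))).
    - apply (rlambda_le_iff r M N p s0 (rlambda r M N p s0)); auto; [apply exp_pos|apply Rle_refl].
    - apply Rmult_le_compat_r; [apply pow_le, Rlt_le, exp_pos|].
      apply Rmult_le_compat_r; [apply Rlt_le, HNp|].
      apply pow_incr. split; [apply pos_INR|]. apply le_INR. unfold s. lia. }
  assert (Hlq : forall p, (1 <= p)%nat -> l p <= rquot r N p).
  { intros p Hp. apply Rle_Rpower_l.
    - apply Rlt_le, Rinv_0_lt_compat, lt_0_INR. lia.
    - split; [now apply lambda_pos|]. now apply lambda_le_quot. }
  assert (Hsum : forall p k, (1 <= p)%nat ->
    fsum (fun k => / rquot r N (S k)) p k <= Rabs B0 * (INR p / l p)).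
  { intros p k Hp. specialize (HB0 p Hp). specialize (Hex p Hp). simpl in HB0.
    set (g := fun k => Rpower (/ quot N (p + k)) (/ INR r)) in *.
    assert (Hg : forall k, 0 <= g k) by (intros; apply Rlt_le, exp_pos).
    assert (Hpp : 0 < INR p) by (apply lt_0_INR; lia).
    apply Rle_trans with (Series g).
    - apply Rle_trans with (2 := sum_n_le_Series g k Hg Hex).
      (* The cutoff uses nu_k for k > p only, so the term k = p of the series is discarded. *)
      rewrite (fsum_shift (fun k => / rquot r N k)).
      rewrite (sum_n_ext g (fun j => / rquot r N (p + j))) by (intros; now apply rquot_inv).
      rewrite <- (fsum_sum_n (fun j => / rquot r N j)). cbn [fsum].
      assert (0 < / rquot r N p) by (apply Rinv_0_lt_compat, rquot_pos). lra.
    - assert (H0 : 0 <= Series g).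
      { apply Rle_trans with (2 := sum_n_le_Series g 0 Hg Hex). rewrite sum_O. apply Hg. }
      assert (Hlp := Hl p). specialize (Hl0 p Hp). fold (rlambda r M N p s0) in HB0.
      apply Rmult_le_reg_r with (l p / INR p); [now apply Rdiv_lt_0_compat|].
      replace (Rabs B0 * (INR p / l p) * (l p / INR p)) with (Rabs B0) by (field; lra).
      apply Rle_trans with (2 := Rle_abs B0). apply Rle_trans with (2 := HB0).
      rewrite Rmult_comm. apply Rmult_le_compat_r; [exact H0|].
      apply Rmult_le_compat_r; [now apply Rlt_le, Rinv_0_lt_compat|exact Hl0]. }
  assert (Hroot : forall p, 1 <= Rpower (M p) (/ INR r)).
  { intros p. rewrite <- (Rpower_O (M p)) by apply HMp. apply Rle_Rpower.
    - now apply LC_ge_1.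
    - apply Rlt_le, Rinv_0_lt_compat, lt_0_INR. lia. }
  destruct (liminf_root_factorial _ Hroot Hlim) as [c [Hc Hcf]].
  (* The index j = 0 in lambda gives M_p^(1/r) <= (s l_p)^p, and the liminf gives c^p p! <=
     M_p^(1/r). With p! >= (p / e)^p this bounds p / l_p. *)
  assert (HB' : forall p, (1 <= p)%nat -> INR p / l p <= exp 1 * INR s / c).
  { intros p Hp. specialize (Hcf p Hp). assert (Hlp := Hl p).
    assert (Hpp : 0 < INR p) by (apply lt_0_INR; lia).
    assert (He := exp_pos 1).
    assert (H1 : Rpower (M p) (/ INR r) <= (INR s * l p) ^ p).
    { apply Rpower_inv_le; [apply HMp|apply pow_lt; nra|lia|].
      apply Rle_trans with (1 := HMN1 p 0%nat Hp).
      rewrite (LC_zero _ HN), Rmult_1_r, Nat.sub_0_r, <- pow_mult, Rpow_mult_distr.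
      rewrite (Nat.mul_comm p r). apply Rmult_le_compat_r; [apply pow_le; lra|].
      apply Rle_pow; [exact Hs1|nia]. }
    assert (H2 : (c * INR p) ^ p <= (exp 1 * (INR s * l p)) ^ p).
    { rewrite !Rpow_mult_distr, <- exp_INR, <- (Rpow_mult_distr (INR s)).
      pose proof (pow_fact_le_exp (INR p) p (Rlt_le _ _ Hpp)) as H2.
      pose proof (INR_fact_lt_0 p) as Hf.
      apply Rle_trans with (exp (INR p) * (c ^ p * INR (fact p))).
      - replace (c ^ p * INR p ^ p) with (INR p ^ p / INR (fact p) * (c ^ p * INR (fact p)))
          by (field; lra).
        apply Rmult_le_compat_r; [|exact H2].
        apply Rmult_le_pos; [apply pow_le|]; lra.
      - apply Rmult_le_compat_l; [apply Rlt_le, exp_pos|lra]. }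
    apply pow_le_inv in H2; [|nra|repeat apply Rmult_lt_0_compat; lra|lia].
    apply Rmult_le_reg_r with (c * l p); [nra|].
    replace (INR p / l p * (c * l p)) with (c * INR p) by (field; lra).
    replace (exp 1 * INR s / c * (c * l p)) with (exp 1 * (INR s * l p)) by (field; lra).
    exact H2. }
  assert (Hmod : forall p, Cmod (a p) <= Rabs A0 * (H ^ p * M p)).
  { intros p. specialize (HA0 p I). simpl in HA0.
    assert (Hd : 0 < H ^ p * M p) by (apply Rmult_lt_0_compat; [now apply pow_lt|apply HMp]).
    apply Rmult_le_compat_r with (r := H ^ p * M p) in HA0; [|lra].
    unfold Rdiv in HA0. rewrite Rmult_assoc, Rinv_l, Rmult_1_r in HA0 by lra.
    apply Rle_trans with (1 := HA0). apply Rmult_le_compat_r; [lra|apply Rle_abs]. }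
  assert (HBc : 0 <= exp 1 * INR s / c).
  { apply Rlt_le, Rdiv_lt_0_compat; [|exact Hc]. pose proof (exp_pos 1). nra. }
  assert (Hlk : forall p k, (1 <= p)%nat -> (p < k)%nat -> l p <= rquot r N k).
  { intros p k Hp Hk. apply Rle_trans with (1 := Hlq p Hp).
    apply rquot_mono; auto. lia. }
  pose proof (real_interpolation r s M N l (Rabs B0) _ Hr HMp HNp (Rabs_pos _) HBc
    (fun p _ => Hl p) HMN1 HMN2 Hlk Hsum HB') as Hreal.
  destruct (Hreal (fun p => fst (a p)) (Rabs A0) H (Rabs_pos _) (Rlt_le _ _ HH))
    as [f [A [h [HA [Hh [Hf Hfj]]]]]].
  { intros p. apply Rle_trans with (2 := Hmod p).
    apply (Rle_trans _ _ _ (Rmax_l _ (Rabs (snd (a p))))), (Rmax_Cmod (a p)). }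
  destruct (Hreal (fun p => snd (a p)) (Rabs A0) H (Rabs_pos _) (Rlt_le _ _ HH))
    as [g [A' [h' [HA' [Hh' [Hg Hgj]]]]]].
  { intros p. apply Rle_trans with (2 := Hmod p).
    apply (Rle_trans _ _ _ (Rmax_r (Rabs (fst (a p))) _)), (Rmax_Cmod (a p)). }
  exists (fun x => (f x, g x)). split.
  - now apply adm_DR with A A' h h'.
  - intros j. unfold CDerive_n. simpl.
    rewrite (surjective_pairing (a j)). f_equal; [apply Hfj|apply Hgj].
Qed.

(** * Uniform kernels *)

(* Baire's theorem for the sup norm weighted by [1 / M]: if the sets [P h] cover
   the unit ball then one of them is dense in some ball. *)
Lemma baire_weighted (M : nat -> R) (P : nat -> (nat -> R) -> Prop) :
  (forall p, 0 < M p) ->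
  (forall a, (forall p, Rabs (a p) <= M p) -> exists h, P h a) ->
  exists h x rho, 0 < rho /\
    forall b, (forall p, Rabs (b p - x p) <= rho * M p) ->
    forall eps, 0 < eps ->
    exists c, P h c /\ forall p, Rabs (c p - b p) <= eps * M p.
Proof.
  intros HM Hcov. apply NNPP. intros Hno.
  (* If the claim fails, then near the centre of any ball, and for any h, there is a smaller ball
     that misses P h. *)
  assert (Hstep : forall t : nat * ((nat -> R) * R), exists be : (nat -> R) * R,
    0 < snd (snd t) ->
    (forall p, Rabs (fst be p - fst (snd t) p) <= snd (snd t) * M p) /\
    0 < snd be /\
    forall c, P (fst t) c -> exists p, snd be * M p < Rabs (c p - fst be p)).
  { intros [h [x rho]]; simpl. apply NNPP. intros Hn. apply Hno.
    exists h, x, rho. split.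
    - apply NNPP. intros Hr. apply Hn. exists (x, 0). intros H. now destruct Hr.
    - intros b Hb eps Heps. apply NNPP. intros Hc. apply Hn. exists (b, eps). intros Hr.
      simpl. repeat split; auto. intros c Hc1. apply NNPP. intros Hp. apply Hc.
      exists c. split; [exact Hc1|]. intros p. apply Rnot_lt_le. intros Hlt.
      apply Hp. now exists p. }
  apply functional_choice in Hstep. destruct Hstep as [G HG].
  (* The new centre lies within half of the old radius and the new radius is at most half of it, so
     the balls are nested; the k-th step avoids P k. *)
  set (next := fun k (t : (nat -> R) * R) =>
    let be := G (k, (fst t, snd t / 2)) in (fst be, Rmin (snd be) (snd t) / 2)).
  set (st := fix st k := match k with O => (fun _ => 0, 1) | S k' => next k' (st k') end).
  assert (Hpos : forall k, 0 < snd (st k)).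
  { induction k as [|k IH]; [simpl; lra|].
    destruct (HG (k, (fst (st k), snd (st k) / 2))) as [_ [H2 _]]; [simpl; lra|].
    change (0 < Rmin (snd (G (k, (fst (st k), snd (st k) / 2)))) (snd (st k)) / 2).
    apply Rdiv_lt_0_compat; [now apply Rmin_pos|lra]. }
  assert (Hstep : forall k,
    (forall p, Rabs (fst (st (S k)) p - fst (st k) p) <= snd (st k) / 2 * M p) /\
    snd (st (S k)) <= snd (st k) / 2 /\
    forall c, P k c -> exists p, snd (st (S k)) * M p < Rabs (c p - fst (st (S k)) p)).
  { intros k. destruct (HG (k, (fst (st k), snd (st k) / 2))) as [H1 [H2 H3]].
    - simpl. pose proof (Hpos k). lra.
    - simpl fst in H1, H3. simpl snd in H1.
      change (fst (st (S k))) with (fst (G (k, (fst (st k), snd (st k) / 2)))).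
      change (snd (st (S k))) with
        (Rmin (snd (G (k, (fst (st k), snd (st k) / 2)))) (snd (st k)) / 2).
      set (be := G (k, (fst (st k), snd (st k) / 2))) in *.
      pose proof (Rmin_l (snd be) (snd (st k))). pose proof (Rmin_r (snd be) (snd (st k))).
      split; [exact H1|]. split; [lra|].
      intros c Hc. destruct (H3 c Hc) as [p Hp]. exists p.
      apply Rle_lt_trans with (2 := Hp).
      apply Rmult_le_compat_r; [apply Rlt_le, HM|lra]. }
  assert (Hdist : forall k d p,
    Rabs (fst (st (k + d)%nat) p - fst (st k) p) <= (snd (st k) - snd (st (k + d)%nat)) * M p).
  { intros k d p. induction d as [|d IH].
    - rewrite Nat.add_0_r, !Rminus_diag, Rabs_R0. lra.
    - replace (k + S d)%nat with (S (k + d)) by lia.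
      destruct (Hstep (k + d)%nat) as [H1 [H2 _]]. specialize (H1 p).
      pose proof (HM p).
      replace (fst (st (S (k + d))) p - fst (st k) p) with
        ((fst (st (S (k + d))) p - fst (st (k + d)%nat) p) +
         (fst (st (k + d)%nat) p - fst (st k) p)) by ring.
      apply Rle_trans with (1 := Rabs_triang _ _). nra. }
  (* In each coordinate the balls are nested intervals: the right endpoints and the radii both
     decrease, hence the centres converge. *)
  assert (Hlim : forall p, exists l : R, is_lim_seq (fun k => fst (st k) p) l).
  { intros p. pose proof (HM p) as Hp.
    destruct (ex_finite_lim_seq_decr (fun k => snd (st k)) 0) as [l1 Hl1].
    { intros k. destruct (Hstep k) as [_ [H2 _]]. pose proof (Hpos k). lra. }
    { intros k. now apply Rlt_le. }
    destruct (ex_finite_lim_seq_decr (fun k => fst (st k) p + snd (st k) * M p) (- M p))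
      as [l2 Hl2].
    { intros k. destruct (Hstep k) as [H1 [H2 _]]. specialize (H1 p).
      apply Rabs_le_between in H1. nra. }
    { intros k. pose proof (Hdist 0%nat k p) as H1. simpl in H1.
      apply Rabs_le_between in H1. pose proof (Hpos k). nra. }
    exists (l2 - l1 * M p).
    apply is_lim_seq_ext with
      (fun k => (fst (st k) p + snd (st k) * M p) - snd (st k) * M p); [intros; ring|].
    apply is_lim_seq_minus'; [exact Hl2|].
    apply (is_lim_seq_scal_r _ (M p) l1 Hl1). }
  apply functional_choice in Hlim. destruct Hlim as [a Ha].
  assert (Hak : forall k p, Rabs (a p - fst (st k) p) <= snd (st k) * M p).
  { intros k p. apply is_lim_seq_abs_le with (1 := Ha p). exists k. intros n Hn.
    replace n with (k + (n - k))%nat by lia.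
    apply Rle_trans with (1 := Hdist k (n - k)%nat p).
    apply Rmult_le_compat_r; [apply Rlt_le, HM|]. pose proof (Hpos (k + (n - k))%nat). lra. }
  destruct (Hcov a) as [h Hh].
  { intros p. pose proof (Hak 0%nat p) as H. simpl in H.
    now rewrite Rminus_0_r, Rmult_1_l in H. }
  destruct (Hstep h) as [_ [_ H3]]. destruct (H3 a Hh) as [p Hp].
  apply (Rlt_not_le _ _ Hp), Hak.
Qed.

(** Baire is applied with P h the jets of functions whose two constants are h + 1. The ball it
    provides has an unknown centre x; approximating x + b and x to within eps / 2 and subtracting
    moves the centre to 0 and doubles A. *)
Lemma jets_dense (r : nat) (M N : nat -> R) :
  (forall n, 0 < M n) -> (forall n, 0 < N n) ->
  (forall a : nat -> C, LambdaR M a -> borel_image r N a) ->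
  exists A h rho, 0 < A /\ 1 <= h /\ 0 < rho /\
    forall b, (forall p, Rabs (b p) <= rho * M p) ->
    forall eps, 0 < eps ->
    exists f, adm r N A h f /\
      forall p, Rabs (Derive_n f (r * p) 0 - b p) <= eps * M p.
Proof.
  intros HM HN Hsurj.
  destruct (baire_weighted M (fun h a => exists f,
    adm r N (INR (S h)) (INR (S h)) f /\ forall p, Derive_n f (r * p) 0 = a p))
    as [h [x [rho [Hrho Hd]]]]; [exact HM| |].
  - intros a Ha. destruct (Hsurj (fun p => RtoC (a p))) as [f [Hf Hfa]].
    { exists 1. split; [lra|]. apply sup_over_finite. exists 1. intros p _.
      rewrite pow1, Rmult_1_l, Cmod_R.
      apply Rmult_le_reg_r with (M p); [apply HM|]. unfold Rdiv.
      rewrite Rmult_assoc, Rinv_l, Rmult_1_r, Rmult_1_l; [apply Ha|apply Rgt_not_eq, HM]. }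
    destruct (DR_adm r N f HN Hf) as [A [h [HA [Hh Had]]]].
    destruct (INR_unbounded (Rmax A h)) as [n Hn].
    pose proof (Rmax_l A h). pose proof (Rmax_r A h).
    exists n, (fun x => Re (f x)). split.
    + apply adm_weaken with A h; auto; try rewrite S_INR; lra.
    + intros p. symmetry. exact (f_equal fst (Hfa p)).
  - assert (Hh1 : 1 <= INR (S h)) by (apply (le_INR 1); lia).
    exists (2 * INR (S h)), (INR (S h)), rho.
    split; [lra|]. split; [exact Hh1|]. split; [exact Hrho|].
    intros b Hb eps Heps. assert (He2 : 0 < eps / 2) by lra.
    destruct (Hd (fun p => x p + b p)) with (eps := eps / 2) as [c1 [[f1 [Hf1 Hj1]] Hc1]];
      [|exact He2|].
    { intros p. replace (x p + b p - x p) with (b p) by ring. apply Hb. }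
    destruct (Hd x) with (eps := eps / 2) as [c2 [[f2 [Hf2 Hj2]] Hc2]]; [|exact He2|].
    { intros p. rewrite Rminus_diag, Rabs_R0. pose proof (HM p). nra. }
    exists (fun t => 1 * f1 t + (-1) * f2 t). split.
    + replace (2 * INR (S h)) with (Rabs 1 * INR (S h) + Rabs (-1) * INR (S h)).
      * now apply adm_linear.
      * rewrite Rabs_R1, Rabs_m1. ring.
    + intros p. rewrite (proj2 (smooth_linear f1 f2 1 (-1) (adm_smooth _ _ _ _ _ Hf1)
                          (adm_smooth _ _ _ _ _ Hf2))), Hj1, Hj2.
      specialize (Hc1 p). specialize (Hc2 p).
      replace (1 * c1 p + -1 * c2 p - b p)
        with ((c1 p - (x p + b p)) + - (c2 p - x p)) by ring.
      apply Rle_trans with (1 := Rabs_triang _ _). rewrite Rabs_Ropp. lra.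
Qed.

(* Successive approximation, as in the open mapping theorem. *)
Lemma jets_uniform (r : nat) (M N : nat -> R) :
  (1 <= r)%nat -> (forall n, 0 < M n) -> (forall n, 0 < N n) ->
  (forall a : nat -> C, LambdaR M a -> borel_image r N a) ->
  exists A h rho, 0 < A /\ 1 <= h /\ 0 < rho /\
    forall b, (forall p, Rabs (b p) <= rho * M p) ->
    exists f, adm r N A h f /\ forall p, Derive_n f (r * p) 0 = b p.
Proof.
  intros Hr HM HN Hsurj.
  destruct (jets_dense r M N HM HN Hsurj) as [A [h [rho [HA [Hh [Hrho Hd]]]]]].
  exists (A * 2), h, rho. split; [lra|]. split; [exact Hh|]. split; [exact Hrho|].
  intros b Hb.
  destruct (functional_choice (fun (b : nat -> R) f =>
    (forall p, Rabs (b p) <= rho * M p) ->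
    adm r N A h f /\ forall p, Rabs (Derive_n f (r * p) 0 - b p) <= rho / 2 * M p))
    as [G HG].
  { intros b'. destruct (classic (forall p, Rabs (b' p) <= rho * M p)) as [H|H].
    - destruct (Hd b' H (rho / 2)) as [f Hf]; [lra|]. now exists f.
    - exists (fun _ => 0). intros H'. now destruct H. }
  (* The error left by one approximation is at most half of the radius, so its double lies in the
     ball again; the weight 2^(-k) in [F] undoes the doublings. *)
  set (res := fix res k := match k with
     | O => b
     | S k' => fun p => 2 * (res k' p - Derive_n (G (res k')) (r * p) 0)
     end).
  assert (Hres : forall k p, Rabs (res k p) <= rho * M p).
  { induction k as [|k IH]; [exact Hb|]. intros p.
    change (Rabs (2 * (res k p - Derive_n (G (res k)) (r * p) 0)) <= rho * M p).
    rewrite Rabs_mult, Rabs_minus_sym, (Rabs_pos_eq 2) by lra.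
    pose proof (proj2 (HG (res k) IH) p). lra. }
  set (F := fun k x => (/ 2) ^ k * G (res k) x).
  assert (HF : forall k, adm r N (A * (/ 2) ^ k) h (F k)).
  { intros k. replace (A * (/ 2) ^ k) with (Rabs ((/ 2) ^ k) * A).
    - apply adm_scal, HG, Hres.
    - rewrite Rabs_pos_eq by (apply pow_le; lra). ring. }
  assert (Hgeom : ex_series (fun k => (/ 2) ^ k))
    by (apply ex_series_geom; rewrite Rabs_pos_eq; lra).
  assert (Hex : ex_series (fun k => A * (/ 2) ^ k))
    by now apply (ex_series_scal_l (K := R_AbsRing) (V := R_NormedModule)).
  destruct (adm_Series r N _ h F Hr HF Hex) as [Hadm HD].
  rewrite Series_scal_l, Series_geom in Hadm by (rewrite Rabs_pos_eq; lra).
  replace (/ (1 - / 2)) with 2 in Hadm by field.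
  exists (fun x => Series (fun k => F k x)). split; [exact Hadm|].
  intros p. rewrite HD. apply is_series_unique.
  (* The partial sums telescope, since the k-th term is the difference of two rescaled residuals. *)
  assert (E : forall n, sum_n (fun k => Derive_n (F k) (r * p) 0) n =
                        b p - (/ 2) ^ S n * res (S n) p).
  { assert (E1 : forall k, Derive_n (F k) (r * p) 0 =
              (/ 2) ^ k * res k p - (/ 2) ^ S k * res (S k) p).
    { intros k. unfold F. rewrite Derive_n_scal_l.
      change (res (S k) p) with (2 * (res k p - Derive_n (G (res k)) (r * p) 0)).
      simpl. field. }
    induction n as [|n IH].
    - rewrite sum_O, E1. simpl (_ ^ 0). rewrite Rmult_1_l. reflexivity.
    - rewrite sum_Sn, IH, E1. unfold plus; simpl. ring. }
  change (is_lim_seq (sum_n (fun k => Derive_n (F k) (r * p) 0)) (b p)).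
  apply is_lim_seq_ext with (fun n => b p - (/ 2) ^ S n * res (S n) p).
  { intros n. now rewrite E. }
  replace (b p) with (b p - 0) at 1 by ring.
  apply is_lim_seq_minus'; [apply is_lim_seq_const|].
  apply is_lim_seq_abs_0.
  apply is_lim_seq_le_le with (fun _ => 0) (fun n => (/ 2) ^ S n * (rho * M p)).
  - intros n. split; [apply Rabs_pos|].
    rewrite Rabs_mult, (Rabs_pos_eq (_ ^ _)) by (apply pow_le; lra).
    apply Rmult_le_compat_l; [apply pow_le; lra|apply Hres].
  - apply is_lim_seq_const.
  - replace (Finite 0) with (Rbar_mult 0 (rho * M p)) by (simpl; f_equal; ring).
    apply is_lim_seq_scal_r.
    apply (is_lim_seq_incr_1 (fun n => (/ 2) ^ n)).
    apply is_lim_seq_geom. rewrite Rabs_pos_eq; lra.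
Qed.

(** rho M p times the p-th unit vector still lies in the ball of [jets_uniform]; dividing the
    solution by rho M p puts 1 / M p into the constant. The orders not divisible by r vanish by
    membership in the class. *)
Lemma kernels_uniform (r : nat) (M N : nat -> R) :
  (1 <= r)%nat -> (forall n, 0 < M n) -> (forall n, 0 < N n) ->
  (forall a : nat -> C, LambdaR M a -> borel_image r N a) ->
  exists A h, 1 <= A /\ 1 <= h /\
    forall p, exists f, adm r N (A / M p) h f /\
      forall n, Derive_n f n 0 = if (n =? r * p)%nat then 1 else 0.
Proof.
  intros Hr HM HN Hsurj.
  destruct (jets_uniform r M N Hr HM HN Hsurj) as [A [h [rho [HA [Hh [Hrho Hd]]]]]].
  exists (1 + A / rho), h. assert (HAr : 0 < A / rho) by now apply Rdiv_lt_0_compat.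
  split; [lra|]. split; [exact Hh|]. intros p. pose proof (HM p) as Hp.
  destruct (Hd (fun q => if (q =? p)%nat then rho * M p else 0)) as [f [Hf Hj]].
  { intros q. pose proof (HM q). destruct (Nat.eqb_spec q p) as [->|_].
    - rewrite Rabs_pos_eq; nra.
    - rewrite Rabs_R0. nra. }
  assert (Hrp : 0 < / (rho * M p)) by (apply Rinv_0_lt_compat; nra).
  exists (fun x => / (rho * M p) * f x). split.
  - apply adm_weaken with (Rabs (/ (rho * M p)) * A) h; auto; try lra.
    + apply Rmult_le_pos; [apply Rabs_pos|lra].
    + rewrite Rabs_pos_eq by lra. apply Rmult_le_reg_r with (M p); [exact Hp|].
      replace (/ (rho * M p) * A * M p) with (A / rho) by (field; lra).
      unfold Rdiv at 2. rewrite (Rmult_assoc (_ + _)), Rinv_l; lra.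
    + now apply adm_scal.
  - intros n. rewrite Derive_n_scal_l.
    pose proof (Nat.div_mod n r ltac:(lia)) as E.
    pose proof (Nat.mod_upper_bound n r ltac:(lia)) as Hm.
    destruct (Nat.eq_dec (n mod r) 0) as [H0|H0].
    + rewrite H0, Nat.add_0_r in E. rewrite E, Hj.
      destruct (Nat.eqb_spec (n / r) p), (Nat.eqb_spec (r * (n / r)) (r * p)); try nia.
      * field. lra.
      * ring.
    + rewrite E, (adm_gap _ _ _ _ _ Hf) by lia.
      destruct (Nat.eqb_spec (r * (n / r) + n mod r) (r * p)) as [E'|_]; [exfalso|ring].
      assert (r * (p - n / r) = n mod r)%nat by nia. destruct (p - n / r)%nat; nia.
Qed.

(** * Bang's estimate and necessity *)

Lemma increment_le (f df g dg : R -> R) (x y : R) :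
  x <= y -> (forall z, is_derive f z (df z)) -> (forall z, is_derive g z (dg z)) ->
  (forall z, x <= z <= y -> Rabs (df z) <= dg z) ->
  Rabs (f y - f x) <= g y - g x.
Proof.
  intros Hxy Hf Hg H.
  destruct (mean_value (fun z => g z - f z) (fun z => dg z - df z) x y) as [c [Hc Ec]].
  { intros z. now apply (is_derive_minus g f). }
  destruct (mean_value (fun z => g z + f z) (fun z => dg z + df z) x y) as [c' [Hc' Ec']].
  { intros z. now apply (is_derive_plus g f). }
  rewrite Rmin_left, Rmax_right in Hc, Hc' by exact Hxy.
  pose proof (H c Hc) as H1. pose proof (H c' Hc') as H2.
  apply Rabs_le_between in H1, H2. apply Rabs_le.
  assert (0 <= (dg c - df c) * (y - x)) by (apply Rmult_le_pos; lra).
  assert (0 <= (dg c' + df c') * (y - x)) by (apply Rmult_le_pos; lra). lra.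
Qed.

(* Bang's estimate: the weighted maximum of the derivatives of order [< m] grows at most
   like [exp (e * q * (z - x))], as long as it dominates the bound for the [m]-th one. *)
Lemma bang_step (g : R -> R) (L : nat -> R) (m : nat) (q beta x y : R) :
  smooth g -> (forall n, 0 < L n) -> 0 < q -> 0 <= beta -> x <= y ->
  (forall n, (n < m)%nat -> L (S n) <= q * L n) ->
  1 <= exp 1 ^ m * beta ->
  (forall n, (n < m)%nat -> Rabs (Derive_n g n x) <= exp 1 ^ n * L n * beta) ->
  (forall z, Rabs (Derive_n g m z) <= L m) ->
  forall n, (n <= m)%nat ->
    Rabs (Derive_n g n y) <= exp 1 ^ n * L n * beta * exp (exp 1 * q * (y - x)).
Proof.
  intros Hg HL Hq Hbeta Hxy Hstep Hm Hx Hmz.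
  assert (He := exp_pos 1).
  (* Downward induction on the order: order m is bounded by hypothesis, since e^m beta >= 1, and
     each lower order by integrating the next one from x. *)
  assert (H : forall d z, (d <= m)%nat -> x <= z <= y ->
    Rabs (Derive_n g (m - d) z) <=
      exp 1 ^ (m - d) * L (m - d)%nat * beta * exp (exp 1 * q * (z - x))).
  { induction d as [|d IH]; intros z Hd Hz.
    - rewrite Nat.sub_0_r. apply Rle_trans with (1 := Hmz z).
      assert (H1 : 1 <= exp (exp 1 * q * (z - x))).
      { assert (0 <= exp 1 * q * (z - x)) by (repeat apply Rmult_le_pos; lra).
        pose proof (exp_ineq1_le (exp 1 * q * (z - x))). lra. }
      replace (exp 1 ^ m * L m * beta * exp (exp 1 * q * (z - x)))
        with (L m * ((exp 1 ^ m * beta) * exp (exp 1 * q * (z - x)))) by ring.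
      rewrite <- (Rmult_1_r (L m)) at 1.
      apply Rmult_le_compat_l; [apply Rlt_le, HL|]. nra.
    - set (n := (m - S d)%nat). assert (En : (m - d)%nat = S n) by (unfold n; lia).
      rewrite En in IH. specialize (Hx n ltac:(unfold n; lia)).
      specialize (Hstep n ltac:(unfold n; lia)).
      set (K := exp 1 ^ n * L n * beta) in *.
      set (Phi := fun z => K * exp (exp 1 * q * (z - x))).
      assert (HPhi : forall t, is_derive Phi t (K * (exp 1 * q * exp (exp 1 * q * (t - x))))).
      { intros t. unfold Phi. auto_derive; [exact I|]. unfold Rminus. ring. }
      pose proof (increment_le (Derive_n g n) (Derive_n g (S n)) Phi _ x z (proj1 Hz)
        (fun t => is_derive_Derive_n g n t Hg) HPhi) as Hinc.
      assert (Hinc' : Rabs (Derive_n g n z - Derive_n g n x) <= Phi z - Phi x).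
      { apply Hinc. intros t Ht. apply Rle_trans with (1 := IH t ltac:(lia) ltac:(lra)).
        (* In the derivative of [Phi] the factor e pays for passing from e^n to e^(n+1), and q for
           passing from L n to L (S n). *)
        replace (K * (exp 1 * q * exp (exp 1 * q * (t - x))))
          with (exp 1 ^ S n * beta * exp (exp 1 * q * (t - x)) * (q * L n))
          by (unfold K; simpl; ring).
        replace (exp 1 ^ S n * L (S n) * beta * exp (exp 1 * q * (t - x)))
          with (exp 1 ^ S n * beta * exp (exp 1 * q * (t - x)) * L (S n)) by ring.
        apply Rmult_le_compat_l; [|exact Hstep].
        apply Rmult_le_pos; [|apply Rlt_le, exp_pos].
        apply Rmult_le_pos; [apply pow_le; lra|exact Hbeta]. }
      assert (EPhi : Phi x = K) by (unfold Phi; rewrite Rminus_diag, Rmult_0_r, exp_0; ring).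
      replace (Derive_n g n z) with ((Derive_n g n z - Derive_n g n x) + Derive_n g n x) by ring.
      apply Rle_trans with (1 := Rabs_triang _ _). fold (Phi z). lra. }
  intros n Hn. replace n with (m - (m - n))%nat by lia. apply H; [lia|lra].
Qed.

(** [bang_step] is used for each k from m down to p + 1 with beta = e^(-r k), the least value it
    admits at order r k. Over the length r / (e q_k) the weighted maximum grows by e^r, which turns
    e^(-r k) into e^(-r (k - 1)), exactly what the next step starts from. Flatness at 0 allows the
    chain to begin at any m. *)
Lemma bang_chain (r p m : nat) (g : R -> R) (L q : nat -> R) :
  smooth g -> (forall n, 0 < L n) -> (forall k, 0 < q k) ->
  (forall k n, (p < k)%nat -> (n < r * k)%nat -> L (S n) <= q k * L n) ->
  (forall k z, (p < k)%nat -> Rabs (Derive_n g (r * k) z) <= L (r * k)%nat) ->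
  (forall n, Derive_n g n 0 = 0) ->
  forall d, (p + d <= m)%nat -> forall n, (n < r * (m - d))%nat ->
    Rabs (Derive_n g n (fsum (fun k => INR r / (exp 1 * q k)) (S (m - d)) d)) <=
      exp 1 ^ n * L n * (/ exp 1) ^ (r * (m - d)).
Proof.
  intros Hg HL Hq Hstep Hbound Hflat.
  assert (He := exp_pos 1). assert (Hei := Rinv_0_lt_compat _ He).
  induction d as [|d IH]; intros Hd n Hn.
  - cbn [fsum]. rewrite Hflat, Rabs_R0.
    repeat apply Rmult_le_pos; try (apply pow_le; lra). apply Rlt_le, HL.
  - set (k := (m - d)%nat) in *. assert (Ek : (m - S d)%nat = (k - 1)%nat) by lia.
    rewrite Ek in Hn |- *. assert (Hk : (p < k)%nat) by lia.
    replace (S (k - 1)) with k by lia. cbn [fsum].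
    set (x := fsum (fun k => INR r / (exp 1 * q k)) (S k) d) in *.
    assert (Hw : 0 <= INR r / (exp 1 * q k)).
    { apply Rmult_le_pos; [apply pos_INR|]. apply Rlt_le, Rinv_0_lt_compat.
      apply Rmult_lt_0_compat; [exact He|apply Hq]. }
    rewrite (Rplus_comm _ x).
    apply Rle_trans with (exp 1 ^ n * L n * (/ exp 1) ^ (r * k) *
      exp (exp 1 * q k * (x + INR r / (exp 1 * q k) - x))).
    + apply bang_step with (r * k)%nat; auto.
      * apply pow_le. lra.
      * lra.
      * rewrite <- Rpow_mult_distr, Rinv_r, pow1; lra.
      * intros j Hj. apply IH; [lia|exact Hj].
      * nia.
    + replace (exp 1 * q k * (x + INR r / (exp 1 * q k) - x)) with (INR r)
        by (field; split; [apply Rgt_not_eq, Hq|lra]).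
      rewrite exp_INR. replace (r * k)%nat with (r * (k - 1) + r)%nat by nia.
      rewrite pow_add. apply Req_le.
      replace (exp 1 ^ n * L n * ((/ exp 1) ^ (r * (k - 1)) * (/ exp 1) ^ r) * exp 1 ^ r)
        with (exp 1 ^ n * L n * (/ exp 1) ^ (r * (k - 1)) * ((/ exp 1) ^ r * exp 1 ^ r)) by ring.
      rewrite <- Rpow_mult_distr, Rinv_l, pow1 by lra. ring.
Qed.

Lemma fact_le_pow (q n : nat) : (q <= n)%nat -> (fact q <= n ^ q)%nat.
Proof.
  revert n. induction q as [|q IH]; intros n Hq; [simpl; lia|].
  rewrite fact_simpl, Nat.pow_succ_r'. apply Nat.mul_le_mono; [lia|]. apply IH. lia.
Qed.

(* [D] stands for [A / M p]; the majorants of [bang_chain] are chosen with step [h * nu_p]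
   below the order [r * p] and [h * nu_k] on the [k]-th block above it. *)
Lemma kernel_length_bound (r p m : nat) (N : nat -> R) (D h : R) (f : R -> R) :
  (1 <= r)%nat -> (1 <= p)%nat -> (p < m)%nat -> LC N -> 0 < D -> 1 <= h ->
  adm r N D h f ->
  (forall n, Derive_n f n 0 = if (n =? r * p)%nat then 1 else 0) ->
  forall j, (j < p)%nat ->
    monom (r * (p - j)) (INR r / (exp 1 * h) * fsum (fun k => / rquot r N k) (S p) (m - p))
    <= 2 * (D * (h ^ (r * p) * N j)).
Proof.
  intros Hr Hp Hm HN HD Hh Hf Hjet j Hj.
  pose proof (LC_pos _ HN) as HNp.
  assert (He := exp_pos 1).
  set (nu := rquot r N p).
  assert (Hnu : 0 < nu) by apply rquot_pos.
  set (w := widths r p nu (rquot r N)).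
  assert (Hw : forall i, 0 < w i).
  { intros i. unfold w, widths. destruct (_ <? _)%nat; [exact Hnu|apply rquot_pos]. }
  (* The factor N p / nu^(r p) makes L (r k) equal to D h^(r k) N k for k >= p; below p,
     log-convexity gives L (r j) <= D h^(r j) N j. *)
  set (L := fun n => D * (N p / nu ^ (r * p)) * (h ^ n * fprod w 0 n)).
  assert (HDN : 0 < D * (N p / nu ^ (r * p))).
  { apply Rmult_lt_0_compat; [exact HD|]. apply Rdiv_lt_0_compat; [apply HNp|now apply pow_lt]. }
  assert (HL : forall n, 0 < L n).
  { intros n. apply Rmult_lt_0_compat; [exact HDN|].
    apply Rmult_lt_0_compat; [apply pow_lt; lra|now apply fprod_pos]. }
  assert (HLstep : forall k n, (p < k)%nat -> (n < r * k)%nat ->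
            L (S n) <= h * rquot r N k * L n).
  { intros k n Hk Hn. unfold L. replace (S n) with (n + 1)%nat at 2 by lia.
    rewrite fprod_add. simpl fprod. simpl pow.
    assert (Hwk : w n <= rquot r N k).
    { unfold w, widths. destruct (Nat.ltb_spec n (r * p)) as [H|H].
      - apply rquot_mono; auto. lia.
      - apply rquot_mono; auto; [lia|]. apply Nat.Div0.div_lt_upper_bound; lia. }
    replace (D * (N p / nu ^ (r * p)) * (h * h ^ n * (fprod w 0 n * (w n * 1))))
      with (D * (N p / nu ^ (r * p)) * (h * h ^ n * fprod w 0 n) * w n) by ring.
    replace (h * rquot r N k * (D * (N p / nu ^ (r * p)) * (h ^ n * fprod w 0 n)))
      with (D * (N p / nu ^ (r * p)) * (h * h ^ n * fprod w 0 n) * rquot r N k) by ring.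
    apply Rmult_le_compat_l; [|exact Hwk].
    apply Rmult_le_pos; [lra|]. repeat apply Rmult_le_pos; try lra; [apply pow_le; lra|].
    now apply Rlt_le, fprod_pos. }
  assert (Hpow : forall k, h ^ k <= h ^ (r * k)) by (intros k; apply Rle_pow; [exact Hh|nia]).
  assert (HLhigh : forall k, (p < k)%nat -> D * (h ^ k * N k) <= L (r * k)%nat).
  { intros k Hk. unfold L. replace (r * k)%nat with (r * p + r * (k - p))%nat at 2 by nia.
    rewrite fprod_add, Nat.add_0_l.
    rewrite (fprod_const _ nu) by (intros i Hi; now apply widths_low).
    rewrite (fprod_blocks r _ (fun k => rquot r N (S k)))
      by (intros i' i Hi' Hi; now apply widths_high).
    pose proof (rquot_prod r N p (k - p) HNp Hr) as E.
    replace (p + (k - p))%nat with k in E by lia. rewrite <- E.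
    set (F := fprod (fun k => rquot r N (S k)) p (k - p) ^ r).
    replace (D * (N p / nu ^ (r * p)) * (h ^ (r * k) * (nu ^ (r * p) * F)))
      with (D * (h ^ (r * k) * (F * N p))) by (field; apply pow_nonzero; lra).
    apply Rmult_le_compat_l; [lra|]. apply Rmult_le_compat_r; [|apply Hpow].
    unfold F. rewrite E. apply Rlt_le, HNp. }
  assert (HLlow : L (r * j)%nat <= D * (h ^ (r * j) * N j)).
  { unfold L. rewrite (fprod_const _ nu) by (intros i Hi; apply widths_low; nia).
    replace (r * p)%nat with (r * j + r * (p - j))%nat by nia. rewrite pow_add.
    pose proof (LC_le_quot_pow N p j HN ltac:(lia)) as H.
    rewrite <- (rquot_pow r N p), <- pow_mult in H by assumption. fold nu in H.
    assert (H1 : nu ^ (r * j) <> 0) by (apply pow_nonzero; lra).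
    assert (H2 : 0 < nu ^ (r * (p - j))) by now apply pow_lt.
    replace (D * (N p / (nu ^ (r * j) * nu ^ (r * (p - j)))) * (h ^ (r * j) * nu ^ (r * j)))
      with (D * (h ^ (r * j) * (N p / nu ^ (r * (p - j))))) by (field; split; lra).
    apply Rmult_le_compat_l; [lra|]. apply Rmult_le_compat_l; [apply pow_le; lra|].
    apply Rmult_le_reg_r with (1 := H2). unfold Rdiv.
    rewrite Rmult_assoc, Rinv_l, Rmult_1_r by lra. exact H. }
  set (g := fun x => 1 * monom (r * p) x + (-1) * f x).
  destruct (smooth_linear (monom (r * p)) f 1 (-1) (proj1 (monom_Derive_n _))
              (adm_smooth _ _ _ _ _ Hf)) as [Hg HDg].
  pose proof (bang_chain r p m g L (fun k => h * rquot r N k) Hg HL) as Hchain.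
  specialize (Hchain (fun k => Rmult_lt_0_compat _ _ (Rlt_le_trans _ _ _ Rlt_0_1 Hh)
    (rquot_pos r N k)) HLstep).
  assert (Hb : forall k z, (p < k)%nat -> Rabs (Derive_n g (r * k) z) <= L (r * k)%nat).
  { intros k z Hk. unfold g. rewrite HDg, (proj2 (monom_Derive_n _)). unfold dmonom_n.
    rewrite (proj2 (Nat.leb_gt _ _)) by nia.
    rewrite Rmult_0_r, Rplus_0_l, Rabs_mult, Rabs_m1, Rmult_1_l.
    apply Rle_trans with (1 := adm_bound _ _ _ _ _ Hf k z). now apply HLhigh. }
  specialize (Hchain Hb).
  assert (Hflat : forall n, Derive_n g n 0 = 0).
  { intros n. unfold g. rewrite HDg, monom_Derive_n_0, Hjet. ring. }
  specialize (Hchain Hflat (m - p)%nat ltac:(lia) (r * j)%nat).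
  replace (m - (m - p))%nat with p in Hchain by lia.
  specialize (Hchain ltac:(nia)).
  set (T := fsum (fun k => INR r / (exp 1 * (h * rquot r N k))) (S p) (m - p)) in Hchain.
  assert (ET : T = INR r / (exp 1 * h) * fsum (fun k => / rquot r N k) (S p) (m - p)).
  { unfold T. rewrite <- fsum_scal. apply fsum_ext. intros i _.
    field. repeat split; try lra. apply Rgt_not_eq, rquot_pos. }
  rewrite <- ET.
  unfold g in Hchain. rewrite HDg, (proj2 (monom_Derive_n _)) in Hchain.
  unfold dmonom_n in Hchain. rewrite (proj2 (Nat.leb_le _ _)) in Hchain by nia.
  replace (r * p - r * j)%nat with (r * (p - j))%nat in Hchain by nia.
  pose proof (adm_bound _ _ _ _ _ Hf j T) as HfT.
  assert (Hexp : exp 1 ^ (r * j) * L (r * j)%nat * (/ exp 1) ^ (r * p) <= L (r * j)%nat).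
  { rewrite pow_inv. apply Rmult_le_reg_r with (exp 1 ^ (r * p)); [now apply pow_lt|].
    rewrite Rmult_assoc, Rinv_l, Rmult_1_r, Rmult_comm by (apply pow_nonzero; lra).
    apply Rmult_le_compat_l; [apply Rlt_le, HL|]. apply Rle_pow; [|nia].
    pose proof (exp_ineq1_le 1). lra. }
  assert (Hhj : h ^ (r * j) <= h ^ (r * p)) by (apply Rle_pow; [exact Hh|nia]).
  pose proof (Hpow j). pose proof (HNp j).
  assert (D * (h ^ (r * j) * N j) <= D * (h ^ (r * p) * N j)).
  { apply Rmult_le_compat_l; [lra|]. apply Rmult_le_compat_r; lra. }
  assert (D * (h ^ j * N j) <= D * (h ^ (r * j) * N j)).
  { apply Rmult_le_compat_l; [lra|]. apply Rmult_le_compat_r; lra. }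
  (* The derivative of order r j of the monomial at T is the sum of those of g and f, each at most D
     h^(r p) N j. *)
  apply Rabs_le_between in Hchain, HfT. lra.
Qed.

Lemma SV_necessary (r : nat) (M N : nat -> R) (K : R) :
  (1 <= r)%nat -> LC M -> LC N ->
  1 <= K -> (forall p, M p <= K ^ p * N p) ->
  (forall a : nat -> C, LambdaR M a -> borel_image r N a) -> SV r M N.
Proof.
  intros Hr HM HN HK HMN Hsurj.
  pose proof (LC_pos _ HM) as HMp. pose proof (LC_pos _ HN) as HNp.
  assert (He := exp_pos 1).
  destruct (kernels_uniform r M N Hr HMp HNp Hsurj) as [A [h [HA [Hh Hker]]]].
  assert (Hr1 : 1 <= INR r) by (apply (le_INR 1); exact Hr).
  assert (Hhr : 1 <= h ^ r) by now apply pow_R1_Rle.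
  (* s >= K serves [lambda_le_quot], and s >= 2 A h^r makes s^p absorb the constant 2 A h^(r p) of
     [kernel_length_bound]. *)
  destruct (INR_unbounded (Rmax K (2 * A * h ^ r))) as [s Hs].
  pose proof (Rmax_l K (2 * A * h ^ r)). pose proof (Rmax_r K (2 * A * h ^ r)).
  assert (Hs0 : (0 < s)%nat) by (apply INR_lt; simpl; lra).
  set (l := fun p => rlambda r M N p s).
  assert (Hl : forall p, 0 < l p) by (intros p; apply exp_pos).
  assert (Hfs : forall p k, (0 < p)%nat ->
    fsum (fun k => / rquot r N k) (S p) k <= exp 1 * h * (INR p / l p)).
  { intros p k Hp. assert (Hpp : 0 < INR p) by now apply lt_0_INR.
    assert (Hpl : 0 < INR p / l p) by now apply Rdiv_lt_0_compat.
    assert (Heh : 0 < exp 1 * h) by nra.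
    destruct (Nat.eq_dec k 0) as [->|Hk]; [cbn [fsum]; nra|].
    set (S := fsum (fun k => / rquot r N k) (Datatypes.S p) k).
    set (T := INR r / (exp 1 * h) * S).
    assert (HS : 0 < S).
    { unfold S. destruct k as [|k]; [lia|]. cbn [fsum].
      pose proof (fsum_nonneg (fun k => / rquot r N k) (Datatypes.S (Datatypes.S p)) k
        (fun i => Rinv_0_lt_compat _ (rquot_pos r N i))).
      pose proof (Rinv_0_lt_compat _ (rquot_pos r N (Datatypes.S p))). lra. }
    assert (Hc : 0 < INR r / (exp 1 * h)) by (apply Rdiv_lt_0_compat; nra).
    assert (HT : 0 < T) by now apply Rmult_lt_0_compat.
    (* With q = r (p - j), [kernel_length_bound] reads M p T^q <= s^p N j q!, and q! <= (r p)^q: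
       this is the criterion for [rlambda] at y = r p / T. *)
    assert (Hlb : l p <= INR r * INR p / T).
    { apply rlambda_le_iff; auto.
      { apply Rdiv_lt_0_compat; [nra|exact HT]. }
      intros j Hj. destruct (Hker p) as [f [Hf Hjet]].
      pose proof (kernel_length_bound r p (p + k) N (A / M p) h f Hr Hp ltac:(lia) HN
        (Rdiv_lt_0_compat _ _ (Rlt_le_trans _ _ _ Rlt_0_1 HA) (HMp p)) Hh Hf Hjet j Hj) as HB.
      replace (p + k - p)%nat with k in HB by lia. fold S in HB. fold T in HB.
      set (q := (r * (p - j))%nat) in *. unfold monom in HB.
      pose proof (INR_fact_lt_0 q) as Hfq.
      assert (Hfact : INR (fact q) <= (INR r * INR p) ^ q).
      { rewrite <- mult_INR, <- pow_INR. apply le_INR, fact_le_pow. unfold q. nia. }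
      assert (Hsp : 2 * A * h ^ (r * p) <= INR s ^ p).
      { apply Rle_trans with ((2 * A * h ^ r) ^ p).
        - rewrite Rpow_mult_distr, <- pow_mult. apply Rmult_le_compat_r; [apply pow_le; lra|].
          rewrite <- (pow_1 (2 * A)) at 1. apply Rle_pow; [lra|lia].
        - apply pow_incr. split; [nra|lra]. }
      assert (HTq : 0 < T ^ q) by now apply pow_lt.
      pose proof (HMp p) as HMpp. pose proof (HNp j) as HNj.
      assert (HB2 : M p * T ^ q <= INR (fact q) * (INR s ^ p * N j)).
      { apply Rle_trans with (INR (fact q) * (2 * A * h ^ (r * p) * N j)).
        - apply Rmult_le_compat_r with (r := INR (fact q) * M p) in HB; [|nra].
          replace (T ^ q / INR (fact q) * (INR (fact q) * M p)) with (M p * T ^ q) in HB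
            by (field; lra).
          replace (2 * (A / M p * (h ^ (r * p) * N j)) * (INR (fact q) * M p))
            with (INR (fact q) * (2 * A * h ^ (r * p) * N j)) in HB by (field; lra).
          exact HB.
        - apply Rmult_le_compat_l; [lra|]. apply Rmult_le_compat_r; lra. }
      unfold Rdiv. rewrite Rpow_mult_distr, pow_inv.
      apply Rmult_le_reg_r with (1 := HTq). apply Rle_trans with (1 := HB2).
      replace (INR s ^ p * N j * ((INR r * INR p) ^ q * / T ^ q) * T ^ q)
        with ((INR r * INR p) ^ q * (INR s ^ p * N j)) by (field; lra).
      apply Rmult_le_compat_r; [|exact Hfact].
      apply Rmult_le_pos; [apply pow_le, pos_INR|lra]. }
    assert (Hlp := Hl p).
    apply Rmult_le_compat_r with (r := T / l p) in Hlb.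
    2:{ now apply Rlt_le, Rdiv_lt_0_compat. }
    replace (l p * (T / l p)) with T in Hlb by (field; lra).
    replace (INR r * INR p / T * (T / l p)) with (INR r * INR p / l p) in Hlb by (field; lra).
    apply Rmult_le_reg_l with (1 := Hc). fold T. apply Rle_trans with (1 := Hlb).
    apply Req_le. field. lra. }
  assert (HMs : forall p, M p <= INR s ^ p * N p).
  { intros p. apply Rle_trans with (1 := HMN p).
    apply Rmult_le_compat_r; [apply Rlt_le, HNp|]. apply pow_incr. lra. }
  assert (Hsum : forall p, (0 < p)%nat ->
    ex_series (fun k => Rpower (/ quot N (p + k)) (/ INR r)) /\
    Series (fun k => Rpower (/ quot N (p + k)) (/ INR r)) <= (1 + exp 1 * h) * (INR p / l p)).
  { intros p Hp. apply ex_series_nonneg_bounded.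
    - intros k. apply Rlt_le, exp_pos.
    - intros k. rewrite (sum_n_ext _ (fun j => / rquot r N (p + j)))
        by (intros; now apply rquot_inv).
      rewrite <- (fsum_sum_n (fun j => / rquot r N j)). cbn [fsum].
      specialize (Hfs p k Hp).
      (* The kernels control only k > p. The term k = p is at most 1 / l_p <= p / l_p, whence the
         summand 1 in the constant 1 + e h. *)
      assert (Hlq : l p <= rquot r N p).
      { apply Rle_Rpower_l; [apply Rlt_le, Rinv_0_lt_compat; lra|].
        split; [now apply lambda_pos|now apply lambda_le_quot]. }
      assert (Hlp := Hl p).
      assert (/ rquot r N p <= INR p / l p); [|lra].
      apply Rle_trans with (/ l p); [now apply Rinv_le_contravar|].
      unfold Rdiv. rewrite <- (Rmult_1_l (/ l p)) at 1.
      apply Rmult_le_compat_r; [now apply Rlt_le, Rinv_0_lt_compat|].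
      apply (le_INR 1). lia. }
  exists s. split; [exact Hs0|]. split; [intros p Hp; now apply Hsum|].
  apply sup_over_finite. exists (1 + exp 1 * h). intros p Hp.
  destruct (Hsum p Hp) as [_ HSp]. fold (rlambda r M N p s). fold (l p).
  assert (Hlp := Hl p). assert (Hpp : 0 < INR p) by now apply lt_0_INR.
  apply Rmult_le_compat_l with (r := l p / INR p) in HSp.
  2:{ now apply Rlt_le, Rdiv_lt_0_compat. }
  replace (l p / INR p * ((1 + exp 1 * h) * (INR p / l p))) with (1 + exp 1 * h) in HSp
    by (field; lra).
  exact HSp.
Qed.

Theorem theorem3p2 (r : nat) (M N : nat -> R)
  (hr : (1 <= r)%nat)
  (hM : LC M) (hN : LC N)
  (hliminf : Rbar_lt 0
     (LimInf_seq (fun p =>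
        Rpower (Rpower (M p) (/ INR r) / INR (fact p)) (/ INR p))))
  (hMN : exists K, 1 <= K /\ forall p, M p <= K ^ p * N p) :
  (forall a : nat -> C, LambdaR M a -> borel_image r N a) <-> SV r M N.
Proof.
  destruct hMN as [K [HK HMN]]. split.
  - now apply SV_necessary with K.
  - now apply SV_sufficient with K.
Qed.
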